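(* Let $m,n\in\mathbb{R}^d$ and $\sigma,\varsigma\in\mathcal{S}_d^+$. Let $\pi^\star:=\nu_{m,\sigma}\times\mathbb{B}$ be the Gaussian Schrödinger bridge coupling between $\nu_{m,\sigma}$ and $\nu_{n,\varsigma}$ on $\mathbb{R}^d\times\mathbb{R}^d$, and for $\epsilon>0$ let $\widehat\pi^\star(\epsilon):=\nu_{\widehat m,\widehat\sigma}\times\widehat{\mathbb{B}}$ be the $\epsilon$-inflated empirical bridge built from the sample moments of two independent collections of $N+1$ i.i.d. samples from $\nu_{m,\sigma}$ and $\nu_{n,\varsigma}$ respectively (see context). Assume: (i) there exists $a\ge0$ such that $\mathcal{D}_2\left(\mathbb{B}(x,\cdot),\mathbb{B}(\overline x,\cdot)\right)\le a\|x-\overline x\|_2$ for all $x,\overline x\in\mathbb{R}^d$; (ii) there exist $0<\underline{C}\le\overline{C}<\infty$ with $\lambda_{\min}(\sigma)\wedge\lambda_{\min}(\varsigma)\ge\underline{C}$ and $\|\sigma\|_2\vee\|\varsigma\|_2\le\overline{C}$; (iii) $\chi\chi'\in\mathcal{S}_d^+$. Let $\mathsf{b}<\infty$ be a constant such that $\mathbb{E}[\mathsf{B}^2]\le\mathsf{b}$, with $\mathsf{B}$ defined in the context. Then there exists $C<\infty$ depending only on $(a,\mathsf{b},\underline{C},\overline{C},\chi)$ such that for any $\epsilon>0$, $d\ge1$ and $N\ge1$, $$\mathbb{E}\left[\mathcal{D}_2\left(\pi^\star,\widehat\pi^\star(\epsilon)\right)^2\right]\le Cd\left(\frac{1+\e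psilon^{-2}}{N}+\epsilon^2\right).$$
   Context: $\mathcal{S}_d^+$ is the set of symmetric positive definite $d\times d$ real matrices; $\nu_{m,\sigma}$ is the Gaussian law on $\mathbb{R}^d$ with mean $m$ and covariance $\sigma$ (possibly degenerate); $\|\cdot\|_2$ is the spectral norm (Euclidean norm for vectors), $\lambda_{\min}$ the smallest eigenvalue. $\mathcal{D}_2$ is the $2$-Wasserstein distance for the Euclidean metric (on $\mathbb{R}^d$, and on $\mathbb{R}^d\times\mathbb{R}^d$ with squared metric $\|x-\overline x\|^2+\|y-\overline y\|^2$). For a probability measure $\mu$ and Markov kernel $K$, $(\mu\times K)(d(x,y)):=\mu(dx)K(x,dy)$. Sample moments: $X_1,\dots,X_{N+1}$ i.i.d. from $\nu_{m,\sigma}$, $\widehat m=\frac1{N+1}\sum_{i=1}^{N+1}X_i$, $\widehat\sigma=\frac1N\sum_{i=1}^{N+1}(X_i-\widehat m)(X_i-\widehat m)'$; $(\widehat n,\widehat\varsigma)$ are defined analogously from an independent collection of $N+1$ i.i.d. samples from $\nu_{n,\varsigma}$. Gaussian bridges. Fix $\beta\in\mathbb{R}^{d\times d}$ and $\tau\in\mathcal{S}_d^+$, and set $\chi:=\tau^{-1}\beta$. Let $\psi(\sigma,\varsigma):=\varsigma^{1/2}(\chi\sigma\chi')\varsigma^{1/2}$, $\omega(\sigma,\varsigma):=\psi(\sigma,\varsigma)^{-1}$, $\omega_\epsilon(\sigma,\varsigma):=(\psi(\sigma,\varsigma)+\epsilon I)^{-1}$; let $R(w):=\left(w+(w/2)^2\right)^{1/2}-w/2$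 for $w\in\mathcal{S}_d^+$. With $G$ standard Gaussian on $\mathbb{R}^d$, $\mathbb{B}(x,\cdot)$ is the law of $n+\kappa\chi(x-m)+\kappa^{1/2}G$ where $\kappa:=\varsigma^{1/2}R(\omega(\sigma,\varsigma))\varsigma^{1/2}$; and, given the samples, $\widehat{\mathbb{B}}(x,\cdot)$ is the law of $\widehat n+\widehat\kappa\chi(x-\widehat m)+\widehat\kappa^{1/2}G$ where $\widehat\kappa:=\widehat\varsigma^{1/2}R(\omega_\epsilon(\widehat\sigma,\widehat\varsigma))\widehat\varsigma^{1/2}$ ($G$ independent of the samples). With $b_{\sigma,k}:=\|\widehat\sigma\|_2^k$ and $b_{\varsigma,k}:=\|\widehat\varsigma\|_2^k$, $$\mathsf{B}:=\max\left\{b_{\varsigma,1}^{1/2},\,b_{\varsigma,1},\,b_{\sigma,1}b_{\varsigma,2}^{1/2},\,b_{\sigma,1}b_{\varsigma,4}^{1/2},\,b_{\sigma,1},\,b_{\sigma,1}b_{\varsigma,1}^{1/2},\,b_{\varsigma,1}b_{\sigma,2}^{1/2},\,b_{\sigma,2}b_{\varsigma,2}^{1/2},\,b_{\sigma,2}b_{\varsigma,4}^{1/2},\,b_{\sigma,1}b_{\varsigma,1}\right\}.$$ (Such a finite constant $\mathsf{b}$ exists because all moments of Gaussian sample covariances are finite.) *)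

(* Defs.v *)
From HB Require Import structures.
From mathcomp Require Import all_boot all_order all_algebra.
From mathcomp Require Import all_classical all_reals all_analysis.
From mathcomp Require Import measurable_realfun.
Import Order.TTheory GRing.Theory Num.Theory.
Import numFieldNormedType.Exports.

Set Implicit Arguments.
Unset Strict Implicit.
Unset Printing Implicit Defensive.

Local Open Scope classical_set_scope.
Local Open Scope ring_scope.

Definition measure_matrix_display : measure_display -> measure_display.
Proof. exact. Qed.

Section measurable_matrix.
Context {disp : measure_display} {T : measurableType disp} (m n : nat).

(* On 'cV[R]_d the sigma-algebra generated by these sets is the Borel one. *)
Definition matrix_cylinders : set (set 'M[T]_(m, n)) :=
  [set A | exists i j (B : set T),
    measurable B /\ A = (fun M : 'M[T]_(m, n) => M i j) @^-1` B].

Let matrix_set0 : <<s matrix_cylinders >> set0.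
Proof. exact: sigma_algebra0. Qed.

Let matrix_setC A : <<s matrix_cylinders >> A -> <<s matrix_cylinders >> (~` A).
Proof. exact: sigma_algebraC. Qed.

Let matrix_bigcup (F : (set 'M[T]_(m, n))^nat) :
  (forall i, <<s matrix_cylinders >> (F i)) ->
  <<s matrix_cylinders >> (\bigcup_i F i).
Proof. exact: sigma_algebra_bigcup. Qed.

HB.instance Definition _ := @isMeasurable.Build (measure_matrix_display disp)
  'M[T]_(m, n) <<s matrix_cylinders >> matrix_set0 matrix_setC matrix_bigcup.

Lemma measurable_entry i j :
  measurable_fun setT (fun M : 'M[T]_(m, n) => M i j).
Proof.
by move=> _ B mB; rewrite setTI; apply: sub_sigma_algebra; exists i, j, B.
Qed.

Lemma measurable_fun_matrix disp' (S : measurableType disp')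
    (f : S -> 'M[T]_(m, n)) :
  (forall i j, measurable_fun setT (fun s => f s i j)) -> measurable_fun setT f.
Proof.
move=> mf; apply: (@measurability _ _ _ _ _ _ matrix_cylinders) => //.
move=> _ [_ [i [j [B [mB ->]]]] <-].
exact: (mf i j).
Qed.

End measurable_matrix.

Section linear_algebra.
Context {R : realType}.

Definition enorm d (x : 'cV[R]_d) : R := Num.sqrt (\sum_i x i 0 ^+ 2).

(* The operator norm induced by the Euclidean norm. *)
Definition specnorm d (A : 'M[R]_d) : R :=
  sup [set enorm (A *m x) | x in [set x : 'cV[R]_d | enorm x <= 1]].

Definition lambda_min d (A : 'M[R]_d) : R := inf [set l | eigenvalue A l].

Definition symmx d (A : 'M[R]_d) : Prop := A^T = A.

Definition psdmx d (A : 'M[R]_d) : Prop :=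
  symmx A /\ forall x : 'cV[R]_d, 0 <= (x^T *m A *m x) 0 0.

Definition pdmx d (A : 'M[R]_d) : Prop :=
  symmx A /\ forall x : 'cV[R]_d, x != 0 -> 0 < (x^T *m A *m x) 0 0.

(* The principal square root; it is unique and exists whenever A is positive
   semidefinite.  The value is 0 when there is no such root. *)
Definition sqrtmx d (A : 'M[R]_d) : 'M[R]_d :=
  xget 0 [set S | psdmx S /\ S *m S = A].

End linear_algebra.

Section gaussian.
Context {R : realType}.

(* normal_prob lives on measurableTypeR R: the same sigma-algebra as on R, but
   with another display. *)
Definition consv d (p : measurableTypeR R * 'cV[R]_d) : 'cV[R]_d.+1 :=
  col_mx (p.1 : R)%:M p.2.

Let measurable_consv d : measurable_fun setT (@consv d).
Proof.
apply: measurable_fun_matrix => i j.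
rewrite /consv; under eq_fun do rewrite /col_mx mxE.
case: (@splitP 1 d i) => k _.
  under eq_fun do rewrite mxE ord1 [j]ord1 eqxx mulr1n.
  have m1 : measurable_fun setT
      (fst : measurableTypeR R * 'cV[R]_d -> measurableTypeR R) by [].
  by move=> _ B mB; exact: (m1 measurableT B mB).
exact: (measurableT_comp (measurable_entry k j) measurable_snd).
Qed.

HB.instance Definition _ d :=
  @isMeasurableFun.Build _ _ _ _ (@consv d) (@measurable_consv d).

(* The d-fold product of normal_prob 0 1; see std_gauss_box. *)
Fixpoint std_gauss d : probability 'cV[R]_d R :=
  match d with
  | 0 => \d_ (0 : 'cV[R]_0)
  | d'.+1 => distribution (normal_prob (0 : R) 1 \x std_gauss d')%E (@consv d')
  end.

Definition affv d (b : 'cV[R]_d) (L : 'M[R]_d) (g : 'cV[R]_d) : 'cV[R]_d :=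
  b + L *m g.

Lemma measurable_mulmxl d disp (S : measurableType disp) (L : 'M[R]_d)
    (f : S -> 'cV[R]_d) :
  measurable_fun setT f -> measurable_fun setT (fun s => L *m f s).
Proof.
move=> mf; apply: measurable_fun_matrix => i j.
under eq_fun do rewrite mxE.
apply: measurable_sum => k; apply: measurable_funM => //.
exact: (measurableT_comp (measurable_entry k j) mf).
Qed.

Lemma measurable_addmx d disp (S : measurableType disp) (f g : S -> 'cV[R]_d) :
  measurable_fun setT f -> measurable_fun setT g ->
  measurable_fun setT (fun s => f s + g s).
Proof.
move=> mf mg; apply: measurable_fun_matrix => i j.
under eq_fun do rewrite mxE.
by apply: measurable_funD; exact: (measurableT_comp (measurable_entry i j)).
Qed.

Let measurable_affv d b L : measurable_fun setT (@affv d b L).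
Proof. by apply: measurable_addmx => //; exact: measurable_mulmxl. Qed.

HB.instance Definition _ d b L :=
  @isMeasurableFun.Build _ _ _ _ (@affv d b L) (@measurable_affv d b L).

Lemma consv0 d (p : R * 'cV[R]_d) : consv p ord0 0 = p.1.
Proof.
rewrite (_ : ord0 = lshift d (0 : 'I_1)); last exact: val_inj.
by rewrite [LHS]col_mxEu mxE.
Qed.

Lemma consvS d (p : R * 'cV[R]_d) i : consv p (lift ord0 i) 0 = p.2 i 0.
Proof.
rewrite (_ : lift ord0 i = rshift 1 i); last exact: val_inj.
by rewrite [LHS]col_mxEd.
Qed.

Lemma std_gauss_box d (A : 'I_d -> set (measurableTypeR R)) :
  (forall i, measurable (A i)) ->
  std_gauss d [set v : 'cV[R]_d | forall i, A i (v i 0)] =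
  (\prod_(i < d) normal_prob (0 : R) 1 (A i))%E.
Proof.
elim: d A => [|d IH] A mA; first by rewrite big_ord0 /= diracE mem_set// => -[].
have mB : measurable [set v : 'cV[R]_d | forall i, A (lift ord0 i) (v i 0)].
  rewrite (_ : mkset _ = \bigcap_(i in [set: 'I_d])
      ((fun v : 'cV[R]_d => v i 0) @^-1` A (lift ord0 i))); last first.
    by apply/seteqP; split=> v /= h i; [move=> _|]; exact: h.
  apply: fin_bigcap_measurable; first exact: finite_finset.
  move=> i _; rewrite -[X in measurable X]setTI.
  exact: (measurable_entry i 0 measurableT (mA (lift ord0 i))).
rewrite big_ord_recl -IH// -product_measure1E//=.
rewrite /distribution /pushforward /=; congr (_ _).
apply/seteqP; split=> -[x v] /=.
  move=> h; split=> [|i].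
    by have := h ord0; rewrite consv0.
  by have := h (lift ord0 i); rewrite consvS.
move=> [hx hv] i; case: (unliftP ord0 i) => [j|] ->.
  by rewrite consvS.
by rewrite consv0.
Qed.

(* The law of m + s^(1/2) G with G standard Gaussian; s may be singular. *)
Definition gauss d (m : 'cV[R]_d) (s : 'M[R]_d) : probability 'cV[R]_d R :=
  distribution (std_gauss d) (affv m (sqrtmx s)).

End gaussian.

Section semidirect.
Context {d1 d2 : measure_display} {T1 : measurableType d1}
  {T2 : measurableType d2} {R : realType}.
Variables (mu : probability T1 R) (K : R.-pker T1 ~> T2).
Local Open Scope ereal_scope.

(* The measure mu(dx) K(x, dy). *)
Definition semidirect (A : set (T1 * T2)) : \bar R :=
  \int[mu]_x K x (xsection A x).

Let semidirect0 : semidirect set0 = 0.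
Proof.
by rewrite /semidirect integral0_eq// => x _; rewrite xsection0 measure0.
Qed.

Let semidirect_ge0 A : 0 <= semidirect A.
Proof. exact: integral_ge0. Qed.

Let semidirect_sigma_additive : semi_sigma_additive semidirect.
Proof.
move=> F mF tF mUF.
rewrite [X in _ --> X](_ : _ = \sum_(n <oo) semidirect (F n)).
  by apply: is_cvg_ereal_nneg_natsum => n _; exact: semidirect_ge0.
rewrite -integral_nneseries//; last first.
  by move=> n; apply: measurable_fun_xsection_finite_kernel => // /[!inE].
apply: eq_integral => x _; apply/esym/cvg_lim => //=; rewrite xsection_bigcup.
apply: (measure_sigma_additive _ (trivIset_xsection tF)) => n.
exact: measurable_xsection.
Qed.

HB.instance Definition _ := isMeasure.Build _ _ _ semidirect
  semidirect0 semidirect_ge0 semidirect_sigma_additive.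

Let semidirect_setT : semidirect setT = 1.
Proof.
have K1 x : K x (xsection setT x) = 1.
  by rewrite -(@prob_kernel _ _ _ _ _ K x) xsectionE.
rewrite /semidirect (eq_integral (cst 1)) => [|x _]; last exact: K1.
rewrite integral_cst// mul1e; exact: probability_setT.
Qed.

HB.instance Definition _ :=
  Measure_isProbability.Build _ _ _ semidirect semidirect_setT.

End semidirect.

Section bridge_kernel.
Context {R : realType} {d : nat}.
Variables (chi : 'M[R]_d) (m n : 'cV[R]_d) (k : 'M[R]_d).

(* The law of n + k chi (x - m) + k^(1/2) G with G standard Gaussian. *)
Definition bridge_law (x : 'cV[R]_d) : probability 'cV[R]_d R :=
  gauss (n + k *m chi *m (x - m)) k.

Definition bridge_kernel (x : 'cV[R]_d) : {measure set 'cV[R]_d -> \bar R} :=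
  bridge_law x.

Let measurable_bridge_kernel U :
  measurable U -> measurable_fun setT (bridge_kernel ^~ U).
Proof.
move=> mU.
pose f (z : 'cV[R]_d * 'cV[R]_d) :=
  n + k *m chi *m (z.1 - m) + sqrtmx k *m z.2.
have mf : measurable_fun setT f.
  apply: measurable_addmx; last exact: measurable_mulmxl.
  apply: measurable_addmx; first exact: measurable_cst.
  by apply: measurable_mulmxl; apply: measurable_addmx.
have mfU : measurable (f @^-1` U).
  by rewrite -[X in measurable X]setTI; exact: mf.
have := measurable_fun_xsection (std_gauss d) mfU.
by apply: eq_measurable_fun => x _ /=; rewrite xsectionE.
Qed.

HB.instance Definition _ := isKernel.Build _ _ _ _ _ bridge_kernel
  measurable_bridge_kernel.

Let bridge_kernel_setT x : bridge_kernel x setT = 1%E.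
Proof. exact: probability_setT. Qed.

HB.instance Definition _ := Kernel_isProbability.Build _ _ _ _ _ bridge_kernel
  bridge_kernel_setT.

End bridge_kernel.

Section wasserstein.
Context {disp : measure_display} {T : measurableType disp} {R : realType}.
Local Open Scope ereal_scope.

Definition coupling (mu nu : probability T R) : set (probability (T * T)%type R) :=
  [set p | forall A, measurable A ->
    p (A `*` setT) = mu A /\ p (setT `*` A) = nu A].

(* [sqdist] is the square of the underlying metric. *)
Definition wasserstein2 (sqdist : T -> T -> R) (mu nu : probability T R) :
    \bar R :=
  sqrte (ereal_inf [set \int[p]_z (sqdist z.1 z.2)%:E | p in coupling mu nu]).

End wasserstein.

Section sqdist.
Context {R : realType} {d : nat}.

Definition sqdist (x y : 'cV[R]_d) : R := enorm (x - y) ^+ 2.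

Definition sqdist_pair (z w : 'cV[R]_d * 'cV[R]_d) : R :=
  enorm (z.1 - w.1) ^+ 2 + enorm (z.2 - w.2) ^+ 2.

End sqdist.

Section samples.
Context {disp : measure_display} {Omega : measurableType disp} {R : realType}
  (P : probability Omega R) (d : nat).
Local Notation RVd := {RV P >-> 'cV[R]_d}.

Definition mutually_independent (I : finType) (Z : I -> RVd) : Prop :=
  forall (J : {set I}) (A : I -> set 'cV[R]_d),
    (forall i, measurable (A i)) ->
    P (\bigcap_(i in [set` J]) Z i @^-1` A i) =
    (\prod_(i in J) P (Z i @^-1` A i))%E.

Definition has_law (Z : RVd) (mu : probability 'cV[R]_d R) : Prop :=
  forall A, measurable A -> distribution P Z A = mu A.

(* Two independent collections, of i.i.d. samples from mu and from nu. *)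
Definition iid_samples (N : nat) (X Y : 'I_N -> RVd)
    (mu nu : probability 'cV[R]_d R) : Prop :=
  [/\ forall i, has_law (X i) mu,
      forall i, has_law (Y i) nu &
      mutually_independent (fun i : 'I_N + 'I_N =>
        match i with inl j => X j | inr j => Y j end)].

End samples.

Section sample_moments.
Context {R : realType} {d N : nat}.

Definition smean (x : 'I_N.+1 -> 'cV[R]_d) : 'cV[R]_d :=
  N.+1%:R^-1 *: \sum_i x i.

Definition scov (x : 'I_N.+1 -> 'cV[R]_d) : 'M[R]_d :=
  N%:R^-1 *: \sum_i (x i - smean x) *m (x i - smean x)^T.

End sample_moments.

Section bridges.
Context {R : realType} {d : nat}.
Variable chi : 'M[R]_d.

Definition psi (s v : 'M[R]_d) : 'M[R]_d :=
  sqrtmx v *m (chi *m s *m chi^T) *m sqrtmx v.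

Definition omega_eps (eps : R) (s v : 'M[R]_d) : 'M[R]_d :=
  invmx (psi s v + eps%:M).

Definition omega (s v : 'M[R]_d) : 'M[R]_d := invmx (psi s v).

Definition riccati (w : 'M[R]_d) : 'M[R]_d :=
  sqrtmx (w + (2^-1 *: w) *m (2^-1 *: w)) - 2^-1 *: w.

Definition kappa (s v : 'M[R]_d) : 'M[R]_d :=
  sqrtmx v *m riccati (omega s v) *m sqrtmx v.

Definition kappa_eps (eps : R) (s v : 'M[R]_d) : 'M[R]_d :=
  sqrtmx v *m riccati (omega_eps eps s v) *m sqrtmx v.

Definition bridge (m : 'cV[R]_d) (s : 'M[R]_d) (n : 'cV[R]_d) (v : 'M[R]_d) :
    probability ('cV[R]_d * 'cV[R]_d)%type R :=
  semidirect (gauss m s) (bridge_kernel chi m n (kappa s v)).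

Definition bridge_eps (eps : R) (m : 'cV[R]_d) (s : 'M[R]_d) (n : 'cV[R]_d)
    (v : 'M[R]_d) : probability ('cV[R]_d * 'cV[R]_d)%type R :=
  semidirect (gauss m s) (bridge_kernel chi m n (kappa_eps eps s v)).

End bridges.

(* All the terms are nonnegative, so that 0 is neutral for the maximum. *)
Definition moment_max {R : realType} {d : nat} (s v : 'M[R]_d) : R :=
  let bs k := specnorm s ^+ k in
  let bv k := specnorm v ^+ k in
  \big[Num.max/0]_(x <- [:: Num.sqrt (bv 1); bv 1; bs 1 * Num.sqrt (bv 2);
    bs 1 * Num.sqrt (bv 4); bs 1; bs 1 * Num.sqrt (bv 1);
    bv 1 * Num.sqrt (bs 2); bs 2 * Num.sqrt (bv 2); bs 2 * Num.sqrt (bv 4);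
    bs 1 * bv 1]) x.

(* Main.v *)
From HB Require Import structures.
Require Import Defs.
From mathcomp Require Import all_boot all_order all_algebra.
From mathcomp Require Import complex.
From mathcomp Require Import all_classical all_reals all_analysis.
From mathcomp Require Import measurable_realfun ring lra.
Import Order.TTheory GRing.Theory Num.Theory.
Import numFieldNormedType.Exports.
Set Implicit Arguments.
Unset Strict Implicit.
Unset Printing Implicit Defensive.
Local Open Scope classical_set_scope.
Local Open Scope ring_scope.

(** Both bridges are images of the same pair [(z, g)] of independent standard
    Gaussian vectors, under
      [(z, g) |-> (m + s^(1/2) z, n + k chi s^(1/2) z + k^(1/2) g)].
    Coupling them through [(z, g)] bounds the squared Wasserstein distance by
    a constant times [|m - m'|^2 + |n - n'|^2] plus the [gap], the squared
    Frobenius distance between the matrices [s^(1/2)], [k chi s^(1/2)] and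
    [k^(1/2)] of the two maps ([wasserstein_bridge_le]).

    The gap is controlled by the identity
      [R(p^-1) = (T p)^-1] where [T p = (p + 1/4)^(1/2) + 1/2]
    ([riccatiE]), in which [p] is no longer inverted: [p |-> R(p^-1)] is
    bounded and Lipschitz on the whole positive semidefinite cone
    ([root_inv_lip]), so that neither the degeneracy of the empirical [psi]
    nor the inverse of [eps] enters the bound.  Since the matrix square root
    is Lipschitz at a matrix that is bounded below ([psd_sqr_lip]), the gap is
    quadratic in the errors on the covariances when these are at most 1
    ([gap_local]).  When they are larger, [r p r + r = 1] with [r = R(p^-1)]
    shows that the second moments of a bridge are at most linear in the
    covariances ([gap_global]).  Both regimes together give
      [gap <= C (phi |s - s'| + phi |v - v'| + eps^2)],
    where [phi x] is [x^2] for [x <= 1] and [x] beyond ([gap_capped]).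

    The linear growth of [phi] makes second moments sufficient.  The error of
    a sample covariance is an average of centered, pairwise independent
    matrices, plus a term of order [1 / N], minus a multiple of [u u^T], with
    [u] the error of the sample mean ([scov_centered]).  The average enters
    [phi] through its square, the last term through its norm, which is at most
    [2 |u|^2]; both have expectation of order [1 / N], because the cross terms
    in the square of a sum of centered independent matrices have mean zero
    ([mean_fsq_sum]). *)

(** * Spectral decomposition of real symmetric matrices *)

Section spectral.
Local Open Scope sesquilinear_scope.

(** The weights [c i] are the squared moduli of the coordinates of [x] in a
    unitary eigenbasis over the complex numbers.  They serve all real
    polynomials [p] at once, and a polynomial in [A] is a real matrix, so that
    functions of [A] can be studied without returning to the complex basis. *)
Lemma spectral_form (R : rcfType) d (A : 'M[R]_d.+1) : A^T = A ->
  exists2 l : 'I_d.+1 -> R, (forall i, eigenvalue A (l i)) &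
  forall x : 'cV_d.+1, exists2 c : 'I_d.+1 -> R, (forall i, 0 <= c i) &
    forall p, (x^T *m horner_mx A p *m x) 0 0 = \sum_i p.[l i] * c i.
Proof.
move=> symA; pose f : {rmorphism R -> R[i]} := real_complex R.
pose Ac := map_mx f A.
have fR x : f x \is Num.real by apply/complex_realP; exists x.
have herm : Ac \is hermsymmx.
  apply: realsym_hermsym; last by apply/mxOverP => i j; rewrite mxE.
  apply/is_hermitianmxP; rewrite expr0 scale1r map_mx_id//=.
    by rewrite /Ac map_trmx symA.
have := hermitian_spectral_diag_real herm.
have := hermitian_normalmx herm => /orthomx_spectralP.
have := spectral_unitarymx Ac.
set P := spectralmx Ac; set sp := spectral_diag Ac => unP AE /mxOverP spR.
have Pu := unitarymx_unit unP.
pose l i := complex.Re (sp 0 i).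
have spE i : sp 0 i = f (l i).
  by have /complex_realP[r rE] := spR 0 i; rewrite /l rE.
exists l => [i|x].
  rewrite -(eigenvalue_map f) -/Ac -spE; apply/eigenvalueP; exists (row i P).
    rewrite AE -row_mul !mulmxA mulmxV// mul1mx.
    by apply/rowP => j; rewrite mul_diag_mx !mxE.
  apply/eqP => /(congr1 (mulmx^~ (invmx P))).
  rewrite mul0mx -row_mul mulmxV// => /rowP/(_ i); rewrite !mxE eqxx => /eqP.
  by rewrite oner_eq0.
pose y := P *m map_mx f x.
pose c i : R := complex.Re (y i 0 * (y i 0)^*).
have cE i : y i 0 * (y i 0)^* = f (c i).
  have : y i 0 * (y i 0)^* \is Num.real by rewrite ger0_real// mul_conjC_ge0.
  by move=> /complex_realP[r rE]; rewrite /c rE.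
exists c => [i|p].
  by rewrite -ler0c [X in 0 <= X](_ : _ = f (c i))// -cE mul_conjC_ge0.
apply: (@complexI R); rewrite -[LHS]/(f _) -[RHS]/(f _).
have -> : f ((x^T *m horner_mx A p *m x) 0 0) =
   (map_mx f (x^T *m horner_mx A p *m x)) 0 0. by rewrite [RHS]mxE.
rewrite !map_mxM map_horner_mx -/Ac AE horner_mx_uconjC//.
rewrite horner_mx_diag invmx_unitary// -!mulmxA -/y !mulmxA.
have -> : map_mx f x^T *m P ^t* = y ^t*.
  rewrite /y trmx_mul map_mxM; congr (_ *m _).
  apply/matrixP => i j; rewrite !mxE. exact/esym/CrealP/fR.
rewrite -mulmxA -/y; clearbody y.
rewrite mul_mx_diag mxE rmorph_sum; apply: eq_bigr => i _.
rewrite !mxE spE horner_map mulrAC [X in X * _]mulrC cE mulrC.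
by rewrite -rmorphM.
Qed.

End spectral.

(** * Frobenius norm and quadratic forms *)

Section frobenius.
Context {R : realType}.

Definition fdot m n (A B : 'M[R]_(m, n)) : R := \tr (A^T *m B).
Definition fsq m n (A : 'M[R]_(m, n)) : R := fdot A A.
Definition fnorm m n (A : 'M[R]_(m, n)) : R := Num.sqrt (fsq A).
Definition qform d (A : 'M[R]_d) (x : 'cV[R]_d) : R := (x^T *m A *m x) 0 0.

Lemma fdotE m n (A B : 'M[R]_(m, n)) : fdot A B = \sum_j \sum_i A i j * B i j.
Proof.
by apply: eq_bigr => j _; rewrite mxE; apply: eq_bigr => i _; rewrite mxE.
Qed.

Lemma fsqE m n (A : 'M[R]_(m, n)) : fsq A = \sum_j \sum_i A i j ^+ 2.
Proof. by rewrite /fsq fdotE. Qed.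

Lemma fsq_ge0 m n (A : 'M[R]_(m, n)) : 0 <= fsq A.
Proof. by rewrite fsqE; do 2!apply: sumr_ge0 => ? _; exact: sqr_ge0. Qed.
Hint Resolve fsq_ge0 : core.

Lemma fsq_entry m n (A : 'M[R]_(m, n)) i j : A i j ^+ 2 <= fsq A.
Proof.
rewrite fsqE (bigD1 j)//= (bigD1 i)//= -addrA lerDl addr_ge0//.
  by apply: sumr_ge0 => ? _; exact: sqr_ge0.
by do 2!apply: sumr_ge0 => ? _; exact: sqr_ge0.
Qed.

Lemma fsq_eq0 m n (A : 'M[R]_(m, n)) : fsq A = 0 -> A = 0.
Proof.
move=> A0; apply/matrixP => i j; rewrite mxE; apply/eqP.
by rewrite -sqrf_eq0 eq_le sqr_ge0 andbT -A0 fsq_entry.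
Qed.

Lemma fnorm_ge0 m n (A : 'M[R]_(m, n)) : 0 <= fnorm A.
Proof. exact: sqrtr_ge0. Qed.
Hint Resolve fnorm_ge0 : core.

Lemma sqr_fnorm m n (A : 'M[R]_(m, n)) : fnorm A ^+ 2 = fsq A.
Proof. exact: sqr_sqrtr. Qed.

Lemma enormE d (x : 'cV[R]_d) : enorm x = fnorm x.
Proof. by rewrite /fnorm fsqE big_ord_recl big_ord0 addr0. Qed.

Lemma fdotC m n (A B : 'M[R]_(m, n)) : fdot A B = fdot B A.
Proof.
by rewrite !fdotE; apply: eq_bigr => j _; apply: eq_bigr => i _; rewrite mulrC.
Qed.

Lemma fdotDr m n (A B C : 'M[R]_(m, n)) : fdot A (B + C) = fdot A B + fdot A C.
Proof. by rewrite /fdot mulmxDr mxtraceD. Qed.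

Lemma fdotZr m n (A B : 'M[R]_(m, n)) c : fdot A (c *: B) = c * fdot A B.
Proof. by rewrite /fdot -scalemxAr mxtraceZ. Qed.

Lemma fdotDl m n (A B C : 'M[R]_(m, n)) : fdot (A + B) C = fdot A C + fdot B C.
Proof. by rewrite fdotC fdotDr ![fdot C _]fdotC. Qed.

Lemma fdotZl m n (A B : 'M[R]_(m, n)) c : fdot (c *: A) B = c * fdot A B.
Proof. by rewrite fdotC fdotZr fdotC. Qed.

Lemma fsqD m n (A B : 'M[R]_(m, n)) : fsq (A + B) = fsq A + fdot A B *+ 2 + fsq B.
Proof. by rewrite /fsq fdotDr !fdotDl (fdotC B A) mulr2n !addrA. Qed.

Lemma fsqZ m n (A : 'M[R]_(m, n)) c : fsq (c *: A) = c ^+ 2 * fsq A.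
Proof. by rewrite /fsq fdotZl fdotZr mulrA. Qed.

Lemma fsqN m n (A : 'M[R]_(m, n)) : fsq (- A) = fsq A.
Proof. by rewrite -scaleN1r fsqZ sqrrN expr1n mul1r. Qed.

Lemma fdot_sqr_le m n (A B : 'M[R]_(m, n)) : fdot A B ^+ 2 <= fsq A * fsq B.
Proof.
have [B0|B0] := eqVneq (fsq B) 0.
  by rewrite B0 (fsq_eq0 B0) -(scale0r 0) fdotZr mul0r expr0n mulr0.
have Bgt : 0 < fsq B by rewrite lt_def B0 fsq_ge0.
have := fsq_ge0 (fsq B *: A + (- fdot A B) *: B).
rewrite fsqD !fsqZ fdotZl fdotZr.
rewrite (_ : _ + _ = fsq B * (fsq A * fsq B - fdot A B ^+ 2)); last by ring.
by rewrite pmulr_rge0// subr_ge0.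
Qed.

Lemma fdot_le m n (A B : 'M[R]_(m, n)) : fdot A B <= fnorm A * fnorm B.
Proof.
apply: (le_trans (ler_norm _)).
by rewrite -sqrtr_sqr -sqrtrM// ler_sqrt ?fdot_sqr_le// mulr_ge0.
Qed.

Lemma fnormD m n (A B : 'M[R]_(m, n)) : fnorm (A + B) <= fnorm A + fnorm B.
Proof.
rewrite -(@ler_pXn2r _ 2)// ?nnegrE ?addr_ge0// sqr_fnorm fsqD sqrrD !sqr_fnorm.
by rewrite lerD2r lerD2l ler_pMn2r// fdot_le.
Qed.

Lemma fnormZ m n (A : 'M[R]_(m, n)) c : fnorm (c *: A) = `|c| * fnorm A.
Proof. by rewrite /fnorm fsqZ sqrtrM ?sqr_ge0// sqrtr_sqr. Qed.

Lemma fnormN m n (A : 'M[R]_(m, n)) : fnorm (- A) = fnorm A.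
Proof. by rewrite /fnorm fsqN. Qed.

Lemma fnormB m n (A B : 'M[R]_(m, n)) : fnorm (A - B) = fnorm (B - A).
Proof. by rewrite -fnormN opprB. Qed.

Lemma fsqT m n (A : 'M[R]_(m, n)) : fsq A^T = fsq A.
Proof. by rewrite /fsq /fdot trmxK mxtrace_mulC. Qed.

Lemma fnormT m n (A : 'M[R]_(m, n)) : fnorm A^T = fnorm A.
Proof. by rewrite /fnorm fsqT. Qed.

Lemma fsqD_le m n (A B : 'M[R]_(m, n)) : fsq (A + B) <= 2 * (fsq A + fsq B).
Proof.
have := fsq_ge0 (A - B); rewrite !fsqD fsqN -[- B]scaleN1r fdotZr => H.
lra.
Qed.

Lemma fsqD3_le m n (A B C : 'M[R]_(m, n)) :
  fsq (A + B + C) <= 3 * (fsq A + fsq B + fsq C).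
Proof.
have := fsq_ge0 (A - B); have := fsq_ge0 (A - C); have := fsq_ge0 (B - C).
have fdotNr (X Y : 'M[R]_(m, n)) : fdot X (- Y) = - fdot X Y.
  by rewrite -scaleN1r fdotZr mulN1r.
rewrite !fsqD !fsqN !fdotDl !fdotNr; lra.
Qed.

Lemma fsq_col m n (A : 'M[R]_(m, n)) : fsq A = \sum_j fsq (col j A).
Proof.
rewrite fsqE; apply: eq_bigr => j _.
by rewrite fsqE big_ord_recl big_ord0 addr0; apply: eq_bigr => i _; rewrite mxE.
Qed.

Lemma col_mulmx m n p (A : 'M[R]_(m, n)) (B : 'M[R]_(n, p)) j :
  col j (A *m B) = A *m col j B.
Proof. by rewrite !colE mulmxA. Qed.

(** The Frobenius norm is computed column by column. *)
Lemma fsq_mulmx_op m n p (A : 'M[R]_(m, n)) (B : 'M[R]_(n, p)) c :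
  (forall x : 'cV[R]_n, fsq (A *m x) <= c * fsq x) -> fsq (A *m B) <= c * fsq B.
Proof.
move=> Ac; rewrite fsq_col [in leRHS]fsq_col mulr_sumr.
by apply: ler_sum => j _; rewrite col_mulmx.
Qed.

Lemma fsq_mulmx m n p (A : 'M[R]_(m, n)) (B : 'M[R]_(n, p)) :
  fsq (A *m B) <= fsq A * fsq B.
Proof.
apply: fsq_mulmx_op => x.
rewrite -fsqT fsq_col -[fsq A]fsqT [fsq A^T]fsq_col mulr_suml.
apply: ler_sum => i _; rewrite -!tr_row !fsqT.
have -> : fsq (row i (A *m x)) = fdot (row i A)^T x ^+ 2.
  rewrite fsqE !big_ord_recl !big_ord0 !addr0 /fdot trmxK -row_mul; congr (_ ^+ 2).
  by rewrite trace_mx11.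
by rewrite (le_trans (fdot_sqr_le _ _))// fsqT.
Qed.

Lemma fnormM m n p (A : 'M[R]_(m, n)) (B : 'M[R]_(n, p)) :
  fnorm (A *m B) <= fnorm A * fnorm B.
Proof. by rewrite /fnorm -sqrtrM// ler_sqrt ?fsq_mulmx// mulr_ge0. Qed.

Lemma fsq1 d : fsq (1%:M : 'M[R]_d) = d%:R.
Proof. by rewrite /fsq /fdot trmx1 mulmx1 mxtrace1. Qed.

Lemma qform_fdot d (A : 'M[R]_d) x : qform A x = fdot x (A *m x).
Proof. by rewrite /qform /fdot mulmxA trace_mx11. Qed.

Lemma qformD d (A B : 'M[R]_d) x : qform (A + B) x = qform A x + qform B x.
Proof. by rewrite /qform mulmxDr mulmxDl mxE. Qed.

Lemma qformZ d (A : 'M[R]_d) c x : qform (c *: A) x = c * qform A x.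
Proof. by rewrite /qform -scalemxAr -scalemxAl mxE. Qed.

Lemma qform_scalar d c (x : 'cV[R]_d) : qform c%:M x = c * fsq x.
Proof. by rewrite -scalemx1 qformZ qform_fdot mul1mx. Qed.

Lemma qform_congr d (A B : 'M[R]_d) x : qform (B^T *m A *m B) x = qform A (B *m x).
Proof. by rewrite /qform trmx_mul !mulmxA. Qed.

Lemma qform_gram d (B : 'M[R]_d) x : qform (B^T *m B) x = fsq (B *m x).
Proof. by rewrite /qform -mulmxA -mulmxA mulmxA -trmx_mul /fsq /fdot trace_mx11. Qed.

Lemma fdot_qform d n (A : 'M[R]_d) (D : 'M[R]_(d, n)) :
  fdot D (A *m D) = \sum_j qform A (col j D).
Proof.
rewrite fdotE; apply: eq_bigr => j _.
rewrite qform_fdot -col_mulmx fdotE big_ord_recl big_ord0 addr0.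
by apply: eq_bigr => i _; rewrite ![col _ _ _ _]mxE.
Qed.

(** By polarization, [fdot y (A *m x)] vanishes for all [x] and [y]. *)
Lemma qform_eq0 d (A : 'M[R]_d) : A^T = A -> (forall x, qform A x = 0) -> A = 0.
Proof.
move=> sA A0; apply: fsq_eq0.
have AD x y : qform A (x + y) = qform A x + fdot y (A *m x) *+ 2 + qform A y.
  have -> : fdot y (A *m x) = fdot x (A *m y).
    by rewrite fdotC /fdot trmx_mul sA mulmxA.
  rewrite !qform_fdot mulmxDr !fdotDl !fdotDr (fdotC y) /fdot trmx_mul sA.
  by rewrite -mulmxA; ring.
rewrite fsq_col big1// => j _.
have := AD (delta_mx j 0) (col j A).
rewrite !A0 add0r addr0 -colE => /eqP.
by rewrite eq_sym mulrn_eq0/= => /eqP.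
Qed.

End frobenius.
(* [Resolve] would miss the goals whose order relation is reached through
   another path of the algebraic hierarchy. *)
#[export] Hint Extern 0 (is_true (@Order.le _ _ _ _)) =>
  solve [exact: fsq_ge0 | exact: fnorm_ge0] : core.

(** * Positive semidefinite square roots *)

(** Interpolating the scalar square root at the eigenvalues yields the matrix
    square root as a polynomial in the matrix ([psd_sqrt_exists]). *)
Lemma interpolation (F : fieldType) (h : F -> F) (s : seq F) :
  exists p : {poly F}, forall x, x \in s -> p.[x] = h x.
Proof.
elim: s => [|a s [p pE]]; first by exists 0.
have [as_|as_] := boolP (a \in s).
  by exists p => x; rewrite inE => /orP[/eqP ->|]; exact: pE.
pose q : {poly F} := \prod_(b <- s) ('X - b%:P).
have qa : q.[a] != 0 by rewrite -[_ == 0]/(root q a) root_prod_XsubC.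
exists (p + ((h a - p.[a]) / q.[a])%:P * q) => x.
rewrite inE hornerD hornerM hornerC => /orP[/eqP ->|xs].
  by rewrite divfK// addrC subrK.
have /eqP -> : q.[x] == 0 by rewrite -[_ == 0]/(root q x) root_prod_XsubC.
by rewrite mulr0 addr0 pE.
Qed.

Section psd.
Context {R : realType}.

Lemma qform_ge0 d (A : 'M[R]_d) x : psdmx A -> 0 <= qform A x.
Proof. by case=> _; apply. Qed.

Lemma psdmx_sym d (A : 'M[R]_d) : psdmx A -> A^T = A.
Proof. by case. Qed.

Lemma eigenvalue_fdot d (A : 'M[R]_d) l : eigenvalue A l ->
  exists2 x : 'cV_d, 0 < fsq x & A^T *m x = l *: x.
Proof.
move=> /eigenvalueP[v vA v0]; exists v^T.
  rewrite lt_def fsq_ge0 andbT; apply: contra v0 => /eqP/fsq_eq0 v0.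
  by rewrite -[v]trmxK v0 trmx0.
by rewrite -trmx_mul vA linearZ.
Qed.

Lemma eigenvalue_psd_ge0 d (A : 'M[R]_d) l : psdmx A -> eigenvalue A l -> 0 <= l.
Proof.
move=> pA /eigenvalue_fdot[x x0]; rewrite psdmx_sym// => Ax.
by have := qform_ge0 x pA; rewrite qform_fdot Ax fdotZr pmulr_lge0.
Qed.

(** The weights of [spectral_form] for ['X] and for [1] are the same. *)
Lemma qform_ge_eigen d (A : 'M[R]_d) c : A^T = A ->
  (forall l, eigenvalue A l -> c <= l) -> forall x, c * fsq x <= qform A x.
Proof.
case: d A => [|d] A sA cl x.
  by rewrite qform_fdot fsqE fdotE !big1 ?mulr0// => *; rewrite big_ord0.
have [l eigl lE] := spectral_form sA; have [w w0 wE] := lE x.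
have : \sum_i 1 * w i = fsq x.
  have := wE 1; rewrite rmorph1 mulmx1 => xE.
  rewrite [RHS]/fsq /fdot trace_mx11 xE.
  by apply: eq_bigr => i _; rewrite hornerC.
move=> <-; have := wE 'X; rewrite horner_mx_X -/(qform A x) => ->.
rewrite mulr_sumr; apply: ler_sum => i _; rewrite mul1r hornerX.
by rewrite ler_wpM2r// cl.
Qed.

Lemma psd_sqrt_exists d (A : 'M[R]_d) : psdmx A ->
  exists S : 'M[R]_d, psdmx S /\ S *m S = A.
Proof.
case: d A => [|d] A pA; first by exists A; split => //; by apply/matrixP => -[].
have sA := psdmx_sym pA.
have [l eigl lE] := spectral_form sA.
have [p pE] := interpolation Num.sqrt [seq l i | i <- enum 'I_d.+1].
have {}pE i : p.[l i] = Num.sqrt (l i) by apply: pE; rewrite map_f ?mem_enum.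
have sS q : (horner_mx A q)^T = horner_mx A q.
  elim/poly_ind: q => [|q c IH]; first by rewrite rmorph0 trmx0.
  rewrite rmorphD rmorphM/= horner_mx_X horner_mx_C linearD/= tr_scalar_mx trmx_mul.
  rewrite IH sA; congr (_ + _).
  exact: comm_mx_horner.
exists (horner_mx A p); split; first split => //.
  move=> x; have [w w0 ->] := lE x; apply: sumr_ge0 => i _.
  by rewrite mulr_ge0// pE sqrtr_ge0.
have -> : horner_mx A p *m horner_mx A p = horner_mx A (p * p) by rewrite rmorphM.
apply/eqP; rewrite -subr_eq0 -[X in _ - X](horner_mx_X A) -rmorphB; apply/eqP.
apply: qform_eq0; first exact: sS.
move=> x; have [w w0 wE] := lE x; rewrite /qform wE big1// => i _.
rewrite hornerD hornerN hornerX hornerM pE -expr2 sqr_sqrtr ?subrr ?mul0r//.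
exact: (eigenvalue_psd_ge0 pA).
Qed.

Lemma sqrtmxP d (A : 'M[R]_d) : psdmx A ->
  psdmx (sqrtmx A) /\ sqrtmx A *m sqrtmx A = A.
Proof.
by move=> /psd_sqrt_exists[S SA]; rewrite /sqrtmx; case: xgetP => [_ -> //|/(_ S)].
Qed.

Lemma psd_sqrtmx d (A : 'M[R]_d) : psdmx A -> psdmx (sqrtmx A).
Proof. by case/sqrtmxP. Qed.

Lemma sqrtmxK d (A : 'M[R]_d) : psdmx A -> sqrtmx A *m sqrtmx A = A.
Proof. by case/sqrtmxP. Qed.

Lemma sqrtmx_sym d (A : 'M[R]_d) : psdmx A -> (sqrtmx A)^T = sqrtmx A.
Proof. by move=> /psd_sqrtmx/psdmx_sym. Qed.

Lemma fdot_cycle d (A D : 'M[R]_d) : fdot D (D *m A) = fdot D^T (A *m D^T).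
Proof.
by rewrite /fdot trmxK !mulmxA [RHS]mxtrace_mulC mulmxA.
Qed.

(** [D = A - B] solves the Sylvester equation [A D + D B = A^2 - B^2].  Pairing
    it with [D] in the Frobenius product gives two sums of quadratic forms at
    the columns of [D], one bounded below through [A], the other nonnegative. *)
Lemma psd_sqr_lip d (A B : 'M[R]_d) c : (forall x, c * fsq x <= qform A x) ->
  psdmx A -> psdmx B -> 0 <= c ->
  c * fnorm (A - B) <= fnorm (A *m A - B *m B).
Proof.
move=> cA pA pB c0; set D := A - B.
have sD : D^T = D by rewrite /D linearB/= !psdmx_sym.
have [D0|D0] := eqVneq (fnorm D) 0; first by rewrite D0 mulr0 fnorm_ge0.
have Dgt : 0 < fnorm D by rewrite lt_def D0 fnorm_ge0.
rewrite -(ler_pM2l Dgt) mulrCA -expr2 sqr_fnorm; apply: le_trans (fdot_le _ _).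
have -> : A *m A - B *m B = A *m D + D *m B.
  by rewrite /D mulmxBr mulmxBl addrA subrK.
rewrite fdotDr fdot_cycle sD !fdot_qform.
rewrite -[leLHS]addr0; apply: lerD; last by apply: sumr_ge0 => j _; exact: qform_ge0.
by rewrite fsq_col mulr_sumr ler_sum.
Qed.

(** With a zero right-hand side in the Sylvester equation of [psd_sqr_lip], both
    roots kill the columns of [D], hence so does [D] itself. *)
Lemma psd_sqr_inj d (A B : 'M[R]_d) : psdmx A -> psdmx B ->
  A *m A = B *m B -> A = B.
Proof.
move=> pA pB AB; set D := A - B.
have sD : D^T = D by rewrite /D linearB/= !psdmx_sym.
have E : A *m D + D *m B = 0 by rewrite /D mulmxBr mulmxBl addrA subrK AB subrr.
have := fdotDr D (A *m D) (D *m B); rewrite E fdot_cycle sD !fdot_qform.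
rewrite -(scale0r 0) fdotZr mul0r => /esym/eqP.
rewrite paddr_eq0 ?sumr_ge0//; try by move=> ? _; exact: qform_ge0.
rewrite !psumr_eq0; try by move=> ? _; exact: qform_ge0.
move=> /andP[/allP qA /allP qB].
have ker C j : psdmx C -> qform C (col j D) = 0 -> C *m col j D = 0.
  move=> pC; rewrite -{1}(sqrtmxK pC) -{1}(sqrtmx_sym pC) qform_gram => /fsq_eq0 C0.
  by rewrite -(sqrtmxK pC) -mulmxA C0 mulmx0.
apply/eqP; rewrite -subr_eq0 -/D; apply/eqP; apply: fsq_eq0.
rewrite fsq_col big1// => j _.
have DD : D *m col j D = 0.
  rewrite {1}/D mulmxBl !ker ?subrr//; apply/eqP.
    exact: (qB j (mem_index_enum _)).
  exact: (qA j (mem_index_enum _)).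
by rewrite colE -qform_gram sD qform_fdot -mulmxA -colE DD -(scale0r 0) fdotZr mul0r.
Qed.

End psd.

(** * The Riccati function *)

Section riccati.
Context {R : realType}.

Lemma unitmx_qform d (A : 'M[R]_d) c : 0 < c ->
  (forall x, c * fsq x <= qform A x) -> A \in unitmx.
Proof.
move=> c0 cA; rewrite unitmxE unitfE; apply/negP => /det0P[v v0 vA].
have := cA v^T; rewrite /qform trmxK vA mul0mx mxE.
rewrite pmulr_rle0// => h; move/negP: v0; apply; apply/eqP.
apply: (can_inj (@trmxK _ _ _)); rewrite trmx0; apply: fsq_eq0.
by apply/eqP; rewrite eq_le h fsq_ge0.
Qed.

Lemma psdmxD d (A B : 'M[R]_d) : psdmx A -> psdmx B -> psdmx (A + B).
Proof.
move=> [sA qA] [sB qB]; split; first by rewrite /symmx linearD/= sA sB.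
by move=> x; rewrite mulmxDr mulmxDl mxE addr_ge0.
Qed.

Lemma psdmx_scalar d (c : R) : 0 <= c -> psdmx (c%:M : 'M[R]_d).
Proof.
move=> c0; split; first by rewrite /symmx tr_scalar_mx.
by move=> x; rewrite -/(qform _ x) qform_scalar mulr_ge0.
Qed.

Lemma psdmx_congr d (A B : 'M[R]_d) : psdmx A -> psdmx (B^T *m A *m B).
Proof.
move=> [sA qA]; split; first by rewrite /symmx !trmx_mul trmxK sA mulmxA.
by move=> x; rewrite -/(qform _ x) qform_congr; exact: qA.
Qed.

Lemma psdmx_inv d (A : 'M[R]_d) : psdmx A -> psdmx (invmx A).
Proof.
move=> pA; have [uA|uA] := boolP (A \in unitmx); last by rewrite /invmx (negbTE uA).
have sI : (invmx A)^T = invmx A by rewrite trmx_inv psdmx_sym.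
split => // x; rewrite -/(qform _ x).
have -> : invmx A = (invmx A)^T *m A *m invmx A by rewrite sI mulVmx// mul1mx.
by rewrite qform_congr qform_ge0.
Qed.

Lemma psd_sqr_ge d (A : 'M[R]_d) c : psdmx A -> 0 <= c ->
  (forall x, c ^+ 2 * fsq x <= qform (A *m A) x) ->
  forall x, c * fsq x <= qform A x.
Proof.
move=> pA c0 cA; apply: qform_ge_eigen; first exact: psdmx_sym.
move=> l eigl; have l0 := eigenvalue_psd_ge0 pA eigl.
have [x x0] := eigenvalue_fdot eigl; rewrite psdmx_sym// => Ax.
have := cA x; rewrite qform_fdot -mulmxA Ax -scalemxAr Ax scalerA fdotZr -expr2.
by rewrite ler_pM2r// ler_pXn2r.
Qed.

(** [S] is a function of [p], hence commutes with [w = p^-1], and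
    [(S w)^2 = w + (w/2)^2].  So [R(w) = (S - 1/2) w], while
    [(S - 1/2) (S + 1/2) = p]. *)
Lemma riccati_inv d (p S : 'M[R]_d) : psdmx p -> p \in unitmx -> psdmx S ->
  S *m S = p + (4^-1)%:M -> riccati (invmx p) *m (S + (2^-1)%:M) = 1%:M.
Proof.
move=> pp up pS S2; set w := invmx p.
have pE : p = S *m S - (4^-1)%:M by rewrite S2 addrK.
have Sp : S *m p = p *m S.
  by rewrite pE mulmxBr mulmxBl mulmxA scalar_mxC.
have Sw : S *m w = w *m S.
  rewrite -[LHS]mul1mx -(mulVmx up) -/w -mulmxA [p *m _]mulmxA -Sp.
  by rewrite -mulmxA mulmxV ?mulmx1.
have sw : w^T = w by rewrite trmx_inv psdmx_sym.
have QE : sqrtmx (w + (2^-1 *: w) *m (2^-1 *: w)) = S *m w.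
  have wE : S *m w *m (S *m w) = w + (2^-1 *: w) *m (2^-1 *: w).
    have -> : S *m w *m (S *m w) = S *m S *m w *m w.
      by rewrite -!mulmxA [w *m (S *m w)]mulmxA -Sw !mulmxA.
    rewrite S2 -mulmxA.
    rewrite mulmxDl [p *m _]mulmxA mulmxV// mul1mx mul_scalar_mx.
    by rewrite -scalemxAr -scalemxAl scalerA; congr (_ + _ *: _); field.
  have psw : psdmx (S *m w).
    split; first by rewrite /symmx trmx_mul sw psdmx_sym// Sw.
    move=> x; rewrite -/(qform _ x).
    (* S w is congruent, through w, to S p = S' p S', with S' the root of S *)
    pose S' := sqrtmx S.
    have sS' : S'^T = S' by exact: sqrtmx_sym.
    have S'K : S' *m S' = S by exact: sqrtmxK.
    have -> : S *m w = w^T *m (S'^T *m p *m S') *m w.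
      rewrite sw sS'.
      have -> : S' *m p *m S' = S *m p.
        rewrite pE mulmxBr mulmxBl mulmxBr !mul_mx_scalar -scalemxAl S'K.
        by clearbody S'; congr (_ - _); rewrite -S'K !mulmxA.
      by rewrite !mulmxA -Sw -!mulmxA mulmxV// mulmx1.
    rewrite qform_congr; apply: qform_ge0; exact: psdmx_congr.
  apply: psd_sqr_inj => //.
    apply: psd_sqrtmx; rewrite -wE.
    by rewrite -{1}(psdmx_sym psw) -[_^T]mulmx1; apply: psdmx_congr; apply: psdmx_scalar.
  rewrite sqrtmxK// -wE -{1}(psdmx_sym psw) -[_^T]mulmx1; apply: psdmx_congr.
  exact: psdmx_scalar.
rewrite /riccati QE.
have -> : S *m w - 2^-1 *: w = w *m (S - (2^-1)%:M).
  by rewrite mulmxBr mul_mx_scalar Sw.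
rewrite -mulmxA -[RHS](mulVmx up); congr (_ *m _).
rewrite mulmxBl !mulmxDr S2 scalar_mxC !mul_scalar_mx.
apply/matrixP => i j; rewrite !mxE; case: (i == j); rewrite ?mulr1n ?mulr0n; lra.
Qed.

(** The root [T] of [T^2 - T = p] which is at least 1/2; its inverse is
    [R(p^-1)] by [riccatiE], an expression that makes sense for singular [p]. *)
Definition shifted_root d (p : 'M[R]_d) : 'M[R]_d :=
  sqrtmx (p + (4^-1)%:M) + (2^-1)%:M.

Section root.
Context {d : nat} {p : 'M[R]_d}.
Hypothesis pp : psdmx p.
Local Notation S := (sqrtmx (p + (4^-1)%:M)).
Local Notation T := (shifted_root p).

Let pp4 : psdmx (p + (4^-1)%:M).
Proof. by apply: psdmxD => //; apply: psdmx_scalar; lra. Qed.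

Lemma sqrt_shift_ge x : 2^-1 * fsq x <= qform S x.
Proof.
move: x; apply: psd_sqr_ge; [exact: psd_sqrtmx|lra|move=> x].
rewrite sqrtmxK// qformD qform_scalar.
have := qform_ge0 x pp; have := fsq_ge0 x; lra.
Qed.

Lemma shifted_root_ge x : 2^-1 * fsq x <= qform T x.
Proof.
by rewrite qformD qform_scalar lerDr qform_ge0//; exact: psd_sqrtmx.
Qed.

Lemma psd_shifted_root : psdmx T.
Proof. by apply: psdmxD; [exact: psd_sqrtmx|apply: psdmx_scalar; lra]. Qed.

Lemma shifted_root_unit : T \in unitmx.
Proof. by apply: (@unitmx_qform _ _ 2^-1); [lra|exact: shifted_root_ge]. Qed.

Lemma shifted_rootK : T *m T = T + p.
Proof.
rewrite /shifted_root mulmxDr !mulmxDl sqrtmxK// !mul_scalar_mx mul_mx_scalar.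
apply/matrixP => i j; rewrite !mxE; case: (i == j); rewrite ?mulr1n ?mulr0n; lra.
Qed.

Lemma riccatiE : p \in unitmx -> riccati (invmx p) = invmx T.
Proof.
move=> up; apply: (can_inj (mulmxK shifted_root_unit)).
rewrite mulVmx ?shifted_root_unit//.
by apply: riccati_inv => //; [exact: psd_sqrtmx|exact: sqrtmxK].
Qed.

Local Notation r := (invmx T).

Lemma psd_root_inv : psdmx r.
Proof. exact/psdmx_inv/psd_shifted_root. Qed.

Lemma root_inv_op (x : 'cV[R]_d) : fsq (r *m x) <= 4 * fsq x.
Proof.
have uT : T \in unitmx by exact: shifted_root_unit.
pose z := r *m x; have xE : x = T *m z by rewrite /z mulKVmx.
rewrite -/z [in leRHS]xE.
have [z0|z0] := eqVneq (fnorm z) 0; first by rewrite -sqr_fnorm z0 expr0n mulr_ge0.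
have zgt : 0 < fnorm z by rewrite lt_def z0 fnorm_ge0.
have := shifted_root_ge z; rewrite qform_fdot => /le_trans/(_ (fdot_le _ _)).
rewrite -!sqr_fnorm expr2 mulrCA ler_pM2l// => h.
have h2 : fnorm z <= 2 * fnorm (T *m z) by lra.
rewrite (_ : 4 = 2 ^+ 2); last by ring.
by rewrite -exprMn -expr2 ler_pXn2r ?nnegrE ?mulr_ge0.
Qed.

(** Multiply [T^2 - T = p] by the inverse of [T] on both sides. *)
Lemma root_invE : r *m p *m r + r = 1%:M.
Proof.
have uT : T \in unitmx by exact: shifted_root_unit.
have -> : r *m p *m r = r *m (T *m T - T) *m r.
  by rewrite shifted_rootK addrC addKr.
by rewrite mulmxBr mulmxA mulVmx// mul1mx mulmxBl mulmxV// mul1mx subrK.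
Qed.

Lemma root_inv_ge M x : fsq T <= M -> (2 * M)^-1 * fsq x <= qform r x.
Proof.
have uT : T \in unitmx by exact: shifted_root_unit.
move=> TM; have M0 : 0 <= M by rewrite (le_trans _ TM).
have [->|Mn0] := eqVneq M 0.
  by rewrite mulr0 invr0 mul0r qform_ge0//; exact: psd_root_inv.
have Mgt : 0 < M by rewrite lt_def Mn0.
pose z := r *m x; have xE : x = T *m z by rewrite /z mulKVmx.
have -> : qform r x = qform T z by rewrite !qform_fdot -xE fdotC.
rewrite ler_pdivrMl ?mulr_gt0//.
have xz : fsq x <= M * fsq z.
  by rewrite {1}xE (le_trans (fsq_mulmx _ _))// ler_wpM2r.
apply: (le_trans xz); rewrite -mulrA mulrCA ler_wpM2l//.
have := shifted_root_ge z; lra.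
Qed.

End root.

(** The resolvent identity reduces the claim to [psd_sqr_lip], where the roots
    are bounded below by 1/2, uniformly in [p]. *)
Lemma root_inv_lip d (p q : 'M[R]_d) : psdmx p -> psdmx q ->
  fnorm (invmx (shifted_root p) - invmx (shifted_root q)) <= 8 * fnorm (p - q).
Proof.
move=> pp pq.
set T := shifted_root p; set U := shifted_root q.
have uT : T \in unitmx by exact: shifted_root_unit.
have uU : U \in unitmx by exact: shifted_root_unit.
have -> : invmx T - invmx U = invmx T *m ((U - T) *m invmx U).
  by rewrite mulmxBl mulmxV// mulmxBr mulmx1 mulmxA mulVmx// mul1mx.
have op n (r B : 'M[R]_(d, n)) (A : 'M[R]_d) :
   (forall x : 'cV[R]_d, fsq (A *m x) <= 4 * fsq x) -> fnorm (A *m B) <= 2 * fnorm B.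
  move=> h; rewrite -(@ler_pXn2r _ 2)// ?nnegrE ?mulr_ge0// exprMn !sqr_fnorm.
  by rewrite (_ : 2 ^+ 2 = 4); [exact: fsq_mulmx_op|ring].
apply: (le_trans (op _ 0 _ _ (root_inv_op pp))).
rewrite -[fnorm (_ *m invmx U)]fnormT trmx_mul.
have -> : (invmx U)^T = invmx U by apply: psdmx_sym; exact: psd_root_inv.
have := op _ 0 (U - T)^T _ (root_inv_op pq); rewrite fnormT -/U => h1.
have : 2^-1 * fnorm (U - T) <= fnorm (p - q).
  rewrite fnormB.
  rewrite (_ : T - U =
      sqrtmx (p + (4^-1)%:M) - sqrtmx (q + (4^-1)%:M)); last first.
    by rewrite /T /U /shifted_root opprD addrACA subrr addr0.
  have p4 (t : 'M[R]_d) : psdmx t -> psdmx (t + (4^-1)%:M).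
    by move=> pt; apply: psdmxD => //; apply: psdmx_scalar; lra.
  have := psd_sqr_lip (sqrt_shift_ge pp) (psd_sqrtmx (p4 _ pp)) (psd_sqrtmx (p4 _ pq)).
  rewrite !sqrtmxK; [|exact: p4|exact: p4].
  by rewrite opprD addrACA subrr addr0; apply; lra.
by move: h1; set a := fnorm (_ *m _); set b := fnorm _; set c := fnorm _; lra.
Qed.

End riccati.

(** * Dependence of the bridge on the covariances *)

Section bounds.
Context {R : realType}.

Lemma pdmx_unit d (A : 'M[R]_d) : pdmx A -> A \in unitmx.
Proof.
move=> [_ pA]; rewrite unitmxE unitfE; apply/negP => /det0P[v v0 vA].
have /pA : v^T != 0 by apply: contra v0 => /eqP v0; rewrite -[v]trmxK v0 trmx0.
by rewrite trmxK vA mul0mx mxE ltxx.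
Qed.

Lemma pdmx_psd d (A : 'M[R]_d) : pdmx A -> psdmx A.
Proof.
move=> [sA pA]; split => // x; have [->|x0] := eqVneq x 0.
  by rewrite mulmx0 mxE.
exact/ltW/pA.
Qed.

Lemma fsq_sqrtmx d (s : 'M[R]_d) : psdmx s ->
  fsq (sqrtmx s) <= fnorm (1%:M : 'M[R]_d) * fnorm s.
Proof.
move=> ps; have := fdot_le 1%:M s.
by rewrite /fsq {1}/fdot trmx1 mul1mx /fdot sqrtmx_sym// sqrtmxK.
Qed.

(** A bound [M] common to both matrices and a Lipschitz estimate at scale [t];
    unlike the second alone, the pair is stable under products. *)
Definition close M L (t : R) m n (X X' : 'M[R]_(m, n)) :=
  [/\ fnorm X <= M, fnorm X' <= M & fnorm (X - X') <= L * t].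

Lemma closeM M L M' L' t m n p (X X' : 'M[R]_(m, n)) (Y Y' : 'M[R]_(n, p)) :
  close M L t X X' -> close M' L' t Y Y' ->
  close (M * M') (L * M' + M * L') t (X *m Y) (X' *m Y').
Proof.
move=> [XM XM' XL] [YM YM' YL].
split; [by rewrite (le_trans (fnormM _ _))// ler_pM|
        by rewrite (le_trans (fnormM _ _))// ler_pM|].
rewrite (_ : X *m Y - _ = (X - X') *m Y + X' *m (Y - Y')); last first.
  by rewrite mulmxBl mulmxBr addrA subrK.
rewrite (le_trans (fnormD _ _))// mulrDl lerD//.
  by rewrite (le_trans (fnormM _ _))// mulrAC ler_pM.
by rewrite (le_trans (fnormM _ _))// -mulrA ler_pM.
Qed.

Lemma close_refl t m n (X : 'M[R]_(m, n)) : close (fnorm X) 0 t X X.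
Proof. by split; rewrite // subrr mul0r /fnorm -(scale0r 0) fsqZ expr0n mul0r sqrtr0. Qed.

Lemma close_sqr M L t m n (X X' : 'M[R]_(m, n)) :
  close M L t X X' -> fsq (X - X') <= L ^+ 2 * t ^+ 2.
Proof.
by move=> [_ _ h]; rewrite -sqr_fnorm -exprMn ler_pXn2r ?nnegrE// (le_trans _ h).
Qed.

Lemma close_sqrtmx M L t d (s s' : 'M[R]_d) lo : 0 < lo ->
  psdmx s -> psdmx s' -> (forall x, lo * fsq x <= qform s x) ->
  close M L t s s' ->
  close (Num.sqrt (fnorm (1%:M : 'M[R]_d) * M)) (L / Num.sqrt lo) t
    (sqrtmx s) (sqrtmx s').
Proof.
move=> lo0 ps ps' slo [sM sM' ss].
have M0 : 0 <= M by rewrite (le_trans _ sM).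
split.
- rewrite ler_sqrt ?mulr_ge0// (le_trans (fsq_sqrtmx ps))// ler_wpM2l//.
- rewrite ler_sqrt ?mulr_ge0// (le_trans (fsq_sqrtmx ps'))// ler_wpM2l//.
- rewrite mulrAC ler_pdivlMr ?sqrtr_gt0// mulrC (le_trans _ ss)//.
  rewrite -{2}(sqrtmxK ps) -{2}(sqrtmxK ps').
  apply: psd_sqr_lip (psd_sqrtmx ps) (psd_sqrtmx ps') (sqrtr_ge0 _).
  apply: psd_sqr_ge (psd_sqrtmx ps) (sqrtr_ge0 _) _ => x.
  by rewrite sqr_sqrtr ?(ltW lo0)// sqrtmxK//; exact: slo.
Qed.

Lemma psd_psi d (chi s v : 'M[R]_d) : psdmx s -> psdmx v -> psdmx (psi chi s v).
Proof.
move=> ps pv; rewrite /psi.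
have -> : sqrtmx v *m (chi *m s *m chi^T) *m sqrtmx v =
    (chi^T *m sqrtmx v)^T *m s *m (chi^T *m sqrtmx v).
  by rewrite trmx_mul trmxK (sqrtmx_sym pv) !mulmxA.
exact: psdmx_congr.
Qed.

Lemma psd_psi_eps d (chi s v : 'M[R]_d) e : psdmx s -> psdmx v -> 0 <= e ->
  psdmx (psi chi s v + e%:M).
Proof. by move=> ps pv e0; apply: psdmxD; [exact: psd_psi|exact: psdmx_scalar]. Qed.

Lemma kappa_eps0 d (chi s v : 'M[R]_d) : kappa chi s v = kappa_eps chi 0 s v.
Proof.
rewrite /kappa /kappa_eps /omega /omega_eps (_ : 0%:M = 0) ?addr0//.
by apply/matrixP => i j; rewrite !mxE mul0rn.
Qed.

Lemma psi_eps_unit d (chi s v : 'M[R]_d) e : psdmx s -> psdmx v -> 0 < e ->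
  psi chi s v + e%:M \in unitmx.
Proof.
move=> ps pv e0; apply: (@unitmx_qform _ _ _ e) => // x.
by rewrite qformD qform_scalar lerDr qform_ge0//; exact: psd_psi.
Qed.

Lemma psi_unit d (chi s v : 'M[R]_d) : psdmx v -> s \in unitmx -> v \in unitmx ->
  chi \in unitmx -> psi chi s v + 0%:M \in unitmx.
Proof.
move=> pv us uv uc.
have uV : sqrtmx v \in unitmx by move: uv; rewrite -{1}(sqrtmxK pv) unitmx_mul => /andP[].
rewrite (_ : 0%:M = 0) ?addr0; first by rewrite /psi !unitmx_mul unitmx_tr uV us uc.
by apply/matrixP => i j; rewrite !mxE mul0rn.
Qed.

Lemma kappa_epsE d (chi s v : 'M[R]_d) e : psdmx s -> psdmx v -> 0 <= e ->
  psi chi s v + e%:M \in unitmx ->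
  kappa_eps chi e s v =
  sqrtmx v *m invmx (shifted_root (psi chi s v + e%:M)) *m sqrtmx v.
Proof.
by move=> ps pv e0 up; rewrite /kappa_eps riccatiE//; exact: psd_psi_eps.
Qed.

Lemma psd_kappa_eps d (chi s v : 'M[R]_d) e : psdmx s -> psdmx v -> 0 <= e ->
  psi chi s v + e%:M \in unitmx -> psdmx (kappa_eps chi e s v).
Proof.
move=> ps pv e0 up; rewrite kappa_epsE// -{1}(sqrtmx_sym pv).
by apply/psdmx_congr/psd_root_inv/psd_psi_eps.
Qed.

(** The squared distance between the linear parts of the maps that send a
    standard Gaussian vector to the two bridges. *)
Definition gap d (chi s k s' k' : 'M[R]_d) : R :=
  fsq (sqrtmx s - sqrtmx s') +
  fsq (k *m chi *m sqrtmx s - k' *m chi *m sqrtmx s') +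
  fsq (sqrtmx k - sqrtmx k').

(** With [Q = V chi s^(1/2)], where [V] is the root of [v], one has
    [psi = Q Q^T], and [root_invE] bounds the trace of [r psi r], which is the
    squared norm of [r Q], by the dimension. *)
Lemma kappa_size d (chi s v : 'M[R]_d) e : psdmx s -> psdmx v -> 0 <= e ->
  psi chi s v + e%:M \in unitmx ->
  fsq (sqrtmx (kappa_eps chi e s v)) <= 2 * fsq (sqrtmx v) /\
  fsq (kappa_eps chi e s v *m chi *m sqrtmx s) <= d%:R * fsq (sqrtmx v).
Proof.
move=> ps pv e0 up; have pp := psd_psi_eps chi ps pv e0.
have pk := psd_kappa_eps ps pv e0 up.
rewrite kappa_epsE//; move: pk; rewrite kappa_epsE//.
set p := _ + _ in pp *; set r := invmx _; set V := sqrtmx v.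
set k := _ *m _ *m V => pk.
have sV : V^T = V := sqrtmx_sym pv.
have pr : psdmx r := psd_root_inv pp.
split.
  have -> : fsq (sqrtmx k) = fdot V (r *m V).
    by rewrite /fsq /fdot sqrtmx_sym// sqrtmxK// sV mulmxA.
  rewrite (le_trans (fdot_le _ _))// -sqr_fnorm expr2 mulrCA ler_wpM2l//.
  rewrite -(@ler_pXn2r _ 2) ?nnegrE ?mulr_ge0// exprMn !sqr_fnorm.
  by rewrite (_ : 2 ^+ 2 = 4); [exact/fsq_mulmx_op/root_inv_op|ring].
pose Q := V *m chi *m sqrtmx s.
have -> : k *m chi *m sqrtmx s = V *m (r *m Q) by rewrite /k /Q !mulmxA.
rewrite (le_trans (fsq_mulmx _ _))// mulrC ler_wpM2r//.
have -> : fsq (r *m Q) = \tr (r *m psi chi s v *m r).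
  rewrite -fsqT /fsq /fdot trmxK trmx_mul (psdmx_sym pr) -!mulmxA; congr (\tr (_ *m _)).
  rewrite !mulmxA; congr (_ *m _); rewrite /psi -/V /Q !trmx_mul sqrtmx_sym// sV.
  by rewrite -[in RHS](sqrtmxK ps) !mulmxA.
have -> : psi chi s v = p - e%:M by rewrite /p addrK.
have := root_invE pp; rewrite -/r => /(canRL (addrK _)) rpr.
rewrite mulmxBr mulmxBl rpr mul_mx_scalar -scalemxAl.
rewrite !linearB/= mxtrace1 linearZ/=.
have tr_ge0 : 0 <= \tr r.
  have -> : \tr r = fdot 1%:M (r *m 1%:M) by rewrite /fdot trmx1 mul1mx mulmx1.
  by rewrite fdot_qform; apply: sumr_ge0 => j _; exact: qform_ge0.
have trr_ge0 : 0 <= \tr (r *m r) by rewrite -{1}(psdmx_sym pr); exact: fsq_ge0.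
have := mulr_ge0 e0 trr_ge0; lra.
Qed.

(** Only crude bounds on each of the two maps are used; by [kappa_size] they
    are linear in the covariances. *)
Lemma gap_global d (chi : 'M[R]_d) M : chi \in unitmx -> 0 <= M ->
  exists2 C, 0 <= C & forall s v s' v' e,
    psdmx s -> psdmx v -> psdmx s' -> psdmx v' ->
    s \in unitmx -> v \in unitmx -> fnorm s <= M -> fnorm v <= M -> 0 < e ->
    gap chi s (kappa chi s v) s' (kappa_eps chi e s' v') <=
    C * (1 + fnorm (s - s') + fnorm (v - v')).
Proof.
move=> uc M0; set n1 := fnorm (1%:M : 'M[R]_d).
have n10 : 0 <= n1 by [].
have arith (D x y p q : R) : 0 <= D -> 0 <= x -> 0 <= y ->
    p <= n1 * (2 * M + x) -> q <= n1 * (2 * M + y) ->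
    2 * p + 2 * (D + 2) * q <=
    4 * (2 + D + 1) * n1 * (2 * M + 1) * (1 + x + y).
  move=> D0 x0 y0 hp hq.
  have Mxy := mulr_ge0 M0 (addr_ge0 x0 y0).
  have h1 : 2 * M + x <= (2 * M + 1) * (1 + x + y) by lra.
  have h2 : 2 * M + y <= (2 * M + 1) * (1 + x + y) by lra.
  have hp' := le_trans hp (ler_wpM2l n10 h1).
  have := ler_wpM2l D0 (le_trans hq (ler_wpM2l n10 h2)).
  have := le_trans hq (ler_wpM2l n10 h2).
  move: hp'; set W := n1 * (_ * _) => hp' hq' hD.
  have W0 : 0 <= W by rewrite mulr_ge0// mulr_ge0// !addr_ge0// mulr_ge0.
  have DW := mulr_ge0 D0 W0.
  rewrite (_ : 4 * (2 + D + 1) * n1 * (2 * M + 1) * (1 + x + y) =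
    4 * (D * W) + 12 * W); last by rewrite /W; ring.
  clearbody W; lra.
have sum_le (D a a' b b' g1 g2 g3 p p' q q' : R) : g1 <= 2 * (a + a') ->
    g2 <= 2 * (p + p') -> g3 <= 2 * (q + q') -> p <= D * b -> p' <= D * b' ->
    q <= 2 * b -> q' <= 2 * b' ->
    g1 + g2 + g3 <= 2 * (a + a') + 2 * (D + 2) * (b + b').
  by move=> *; lra.
exists (4 * (2 + d%:R + 1) * n1 * (2 * M + 1)).
  by rewrite !mulr_ge0// ?addr_ge0// ?mulr_ge0.
move=> s v s' v' e ps pv ps' pv' us uv sM vM e0; rewrite kappa_eps0.
have [k1 k2] := kappa_size ps pv (lexx 0) (psi_unit pv us uv uc).
have [k1' k2'] := kappa_size ps' pv' (ltW e0) (psi_eps_unit chi ps' pv' e0).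
have B m n (X Y : 'M[R]_(m, n)) : fsq (X - Y) <= 2 * (fsq X + fsq Y).
  by rewrite (le_trans (fsqD_le _ _))// fsqN.
rewrite /gap.
have b1 := B _ _ (sqrtmx s) (sqrtmx s').
have b2 := B _ _ (kappa_eps chi 0 s v *m chi *m sqrtmx s)
  (kappa_eps chi e s' v' *m chi *m sqrtmx s').
have b3 := B _ _ (sqrtmx (kappa_eps chi 0 s v))
  (sqrtmx (kappa_eps chi e s' v')).
have c1 : fsq (sqrtmx s) <= n1 * M by rewrite (le_trans (fsq_sqrtmx ps))// ler_wpM2l.
have c2 : fsq (sqrtmx v) <= n1 * M by rewrite (le_trans (fsq_sqrtmx pv))// ler_wpM2l.
have tri (X X' : 'M[R]_d) : fnorm X <= M -> fnorm X' <= M + fnorm (X - X').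
  move=> XM; have := fnormD X (X' - X); rewrite addrC subrK (fnormB X' X) => h.
  by rewrite (le_trans h)// lerD2r.
have c1' : fsq (sqrtmx s') <= n1 * (M + fnorm (s - s')).
  by rewrite (le_trans (fsq_sqrtmx ps'))// ler_wpM2l// tri.
have c2' : fsq (sqrtmx v') <= n1 * (M + fnorm (v - v')).
  by rewrite (le_trans (fsq_sqrtmx pv'))// ler_wpM2l// tri.
have c3 : fsq (sqrtmx s) + fsq (sqrtmx s') <= n1 * (2 * M + fnorm (s - s')).
  by apply: le_trans (lerD c1 c1') _; rewrite -mulrDr addrA mulr_natl.
have c4 : fsq (sqrtmx v) + fsq (sqrtmx v') <= n1 * (2 * M + fnorm (v - v')).
  by apply: le_trans (lerD c2 c2') _; rewrite -mulrDr addrA mulr_natl.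
apply: le_trans (sum_le _ _ _ _ _ _ _ _ _ _ _ _ b1 b2 b3 k2 k2' k1 k1') _.
exact: arith (ler0n _ d) (fnorm_ge0 _) (fnorm_ge0 _) c3 c4.
Qed.

(** The bounds propagate from the covariances to their roots, to [psi], to its
    shifted root and to [kappa] by [closeM], [close_sqrtmx] and
    [root_inv_lip].  Roots are only compared at the reference matrices [s],
    [v] and [kappa], which are bounded below. *)
Lemma gap_local d (chi : 'M[R]_d) lo M : chi \in unitmx -> 0 < lo -> 0 <= M ->
  exists2 C, 0 <= C & forall s v s' v' e,
    psdmx s -> psdmx v -> psdmx s' -> psdmx v' ->
    (forall x, lo * fsq x <= qform s x) -> (forall x, lo * fsq x <= qform v x) ->
    fnorm s <= M -> fnorm v <= M -> fnorm s' <= M -> fnorm v' <= M -> 0 < e ->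
    gap chi s (kappa chi s v) s' (kappa_eps chi e s' v') <=
    C * (fnorm (s - s') + fnorm (v - v') + e) ^+ 2.
Proof.
move=> uc lo0 M0; set n1 := fnorm (1%:M : 'M[R]_d).
have n10 : 0 <= n1 by [].
(* MA, Mp, Mr, Mk bound the roots of the covariances, psi, the inverse of its
   shifted root and kappa, and LA, Lp, Lr, Lk are the Lipschitz constants;
   lk bounds kappa from below through MT, a bound for the shifted root. *)
set MA := Num.sqrt (n1 * M).
set LA := 1 / Num.sqrt lo.
pose Mp := MA * (fnorm chi * M * fnorm chi^T) * MA.
pose L1 := (0 * M + fnorm chi * 1) * fnorm chi^T + fnorm chi * M * 0.
pose Lp := (LA * (fnorm chi * M * fnorm chi^T) + MA * L1) * MA +
  MA * (fnorm chi * M * fnorm chi^T) * LA.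
pose Mr := 2 * n1.
pose Lr := 8 * (Lp + n1).
pose Mk := MA * Mr * MA.
pose Lk := (LA * Mr + MA * Lr) * MA + MA * Mr * LA.
pose MT := 2 * (n1 * (Mp + 4^-1 * n1) + 4^-1 * n1 ^+ 2) + 1.
pose lk := (2 * MT)^-1 * lo.
pose Lc := (Lk * fnorm chi + Mk * 0) * MA + Mk * fnorm chi * LA.
have MA0 : 0 <= MA by exact: sqrtr_ge0.
have Mp0 : 0 <= Mp by rewrite /Mp !mulr_ge0.
have MT0 : 0 < MT.
  by rewrite /MT ltr_wpDl// mulr_ge0// addr_ge0// mulr_ge0 ?addr_ge0//
    mulr_ge0// invr_ge0.
have lk0 : 0 < lk by rewrite /lk mulr_gt0// invr_gt0 mulr_gt0.
exists (LA ^+ 2 + Lc ^+ 2 + (Lk / Num.sqrt lk) ^+ 2).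
  by rewrite !addr_ge0 ?sqr_ge0.
move=> s v s' v' e ps pv ps' pv' slo vlo sM vM sM' vM' e0.
rewrite kappa_eps0.
set t := _ + _ + e.
have us := unitmx_qform lo0 slo. have uv := unitmx_qform lo0 vlo.
have up := psi_unit pv us uv uc.
have up' := psi_eps_unit chi ps' pv' e0.
have x0 : 0 <= fnorm (s - s') by []. have y0 : 0 <= fnorm (v - v') by [].
have cs : close M 1 t s s' by split => //; rewrite mul1r /t; lra.
have cv : close M 1 t v v' by split => //; rewrite mul1r /t; lra.
have cA : close MA LA t (sqrtmx s) (sqrtmx s') by exact: close_sqrtmx.
have cV : close MA LA t (sqrtmx v) (sqrtmx v') by exact: close_sqrtmx.
have cX : close (fnorm chi) 0 t chi chi by exact: close_refl.
have cp : close Mp Lp t (psi chi s v) (psi chi s' v').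
  have cX' : close (fnorm chi^T) 0 t chi^T chi^T by exact: close_refl.
  exact: closeM (closeM cV (closeM (closeM cX cs) cX')) cV.
have pp := psd_psi_eps chi ps pv (lexx 0).
have pp' := psd_psi_eps chi ps' pv' (ltW e0).
have nr (p : 'M[R]_d) : psdmx p -> fnorm (invmx (shifted_root p)) <= Mr.
  move=> hp; rewrite -[invmx _]mulmx1 -(@ler_pXn2r _ 2) ?nnegrE ?mulr_ge0//.
  rewrite exprMn !sqr_fnorm (_ : 2 ^+ 2 = 4); last by ring.
  exact/fsq_mulmx_op/root_inv_op.
have cr : close Mr Lr t (invmx (shifted_root (psi chi s v + 0%:M)))
                        (invmx (shifted_root (psi chi s' v' + e%:M))).
  split; [exact: nr|exact: nr|].
  rewrite (le_trans (root_inv_lip pp pp'))// /Lr -mulrA ler_wpM2l//.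
  rewrite opprD addrACA (le_trans (fnormD _ _))// mulrDl lerD//.
    by case: cp.
  have -> : 0%:M - e%:M = (- e) *: 1%:M :> 'M[R]_d.
    by rewrite scalemx1 -raddfB/= sub0r.
  rewrite fnormZ normrN gtr0_norm// mulrC ler_wpM2l// /t; lra.
have ck : close Mk Lk t (kappa_eps chi 0 s v) (kappa_eps chi e s' v').
  by rewrite !kappa_epsE// ?ltW//; exact: closeM (closeM cV cr) cV.
have klo x : lk * fsq x <= qform (kappa_eps chi 0 s v) x.
  rewrite kappa_epsE// -{1}(sqrtmx_sym pv) qform_congr.
  have TM : fsq (shifted_root (psi chi s v + 0%:M)) <= MT.
    rewrite /shifted_root (le_trans (fsqD_le _ _))// /MT -[leLHS]addr0 lerD// ler_wpM2l//.
    have E4 : fnorm ((4^-1)%:M : 'M[R]_d) = 4^-1 * n1.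
      by rewrite -scalemx1 fnormZ ger0_norm// invr_ge0.
    have p4 : psdmx (psi chi s v + 0%:M + (4^-1)%:M).
      by apply: psdmxD => //; apply: psdmx_scalar; rewrite invr_ge0.
    rewrite lerD//.
      rewrite (le_trans (fsq_sqrtmx p4))// ler_wpM2l//.
      rewrite (le_trans (fnormD _ _))// E4 lerD2r.
      rewrite (_ : 0%:M = 0) ?addr0; first by case: cp.
      by apply/matrixP => i j; rewrite !mxE mul0rn.
    rewrite -sqr_fnorm -scalemx1 fnormZ exprMn ger0_norm ?invr_ge0// ler_wpM2r ?sqr_ge0//.
    lra.
  apply: le_trans (root_inv_ge pp _ TM); rewrite /lk -mulrA ler_wpM2l//.
    by rewrite invr_ge0 mulr_ge0// ltW.
  by rewrite -qform_gram (sqrtmx_sym pv) sqrtmxK.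
have pk := psd_kappa_eps ps pv (lexx 0) up.
have pk' := psd_kappa_eps ps' pv' (ltW e0) up'.
have cK := close_sqrtmx lk0 pk pk' klo ck.
have cC : close (Mk * fnorm chi * MA) Lc t (kappa_eps chi 0 s v *m chi *m sqrtmx s)
    (kappa_eps chi e s' v' *m chi *m sqrtmx s').
  exact: closeM (closeM ck cX) cA.
rewrite /gap 2!mulrDl lerD//; [apply: lerD|].
- exact: close_sqr cA.
- exact: close_sqr cC.
- exact: close_sqr cK.
Qed.

End bounds.

(** * Means, and the moments of the scalar Gaussian law *)

Section mean.
Context d (T : measurableType d) (R : realType) (P : probability T R).
Implicit Types f g : T -> R.

Definition intble f := P.-integrable setT (EFin \o f).
Definition mean f : R := Rintegral P setT f.

Lemma intble_meas f : intble f -> measurable_fun setT f.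
Proof. by move=> /measurable_int/measurable_EFinP. Qed.

Lemma intble_cst c : intble (fun=> c).
Proof. exact: finite_measure_integrable_cst. Qed.

Lemma intbleD f g : intble f -> intble g -> intble (fun x => f x + g x).
Proof. by move=> If Ig; exact: (integrableD measurableT If Ig). Qed.

Lemma intbleZ c f : intble f -> intble (fun x => c * f x).
Proof. by move=> If; exact: (integrableZl measurableT c If). Qed.

Lemma intble_sum (I : Type) (s : seq I) (F : I -> T -> R) :
  (forall i, intble (F i)) -> intble (fun x => \sum_(i <- s) F i x).
Proof.
move=> IF; elim: s => [|i s IH].
  by under eq_fun do rewrite big_nil; exact: intble_cst.
by under eq_fun do rewrite big_cons; exact: intbleD.
Qed.

Lemma intble_dom f g : measurable_fun setT f -> intble g ->
  (forall x, `|f x| <= g x) -> intble f.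
Proof.
move=> mf Ig fg; apply: (@le_integrable _ _ _ P _ measurableT _ _ _ _ Ig).
  exact/measurable_EFinP.
by move=> x _; rewrite lee_fin (le_trans (fg x))// ler_norm.
Qed.

Lemma intble_ge0 f : measurable_fun setT f -> (forall x, 0 <= f x) ->
  (\int[P]_x (f x)%:E < +oo)%E -> intble f.
Proof.
move=> mf f0 fy; apply/integrableP; split; first exact/measurable_EFinP.
by under eq_integral do rewrite /= ger0_norm//.
Qed.

Lemma mean_cst c : mean (fun=> c) = c.
Proof. by rewrite /mean Rintegral_cst//= probability_setT mulr1. Qed.

Lemma meanD f g : intble f -> intble g -> mean (fun x => f x + g x) = mean f + mean g.
Proof. by move=> If Ig; exact: RintegralD. Qed.

Lemma meanZ c f : intble f -> mean (fun x => c * f x) = c * mean f.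
Proof. by move=> If; exact: RintegralZl. Qed.

Lemma mean_sum (I : Type) (s : seq I) (F : I -> T -> R) :
  (forall i, intble (F i)) ->
  mean (fun x => \sum_(i <- s) F i x) = \sum_(i <- s) mean (F i).
Proof.
move=> IF; elim: s => [|i s IH].
  by rewrite big_nil; under eq_fun do rewrite big_nil; exact: mean_cst.
rewrite big_cons -IH; under eq_fun do rewrite big_cons.
by rewrite meanD//; exact: intble_sum.
Qed.

Lemma mean_le f g : intble f -> intble g -> (forall x, f x <= g x) ->
  mean f <= mean g.
Proof. by move=> If Ig fg; exact: le_Rintegral. Qed.

Lemma mean_ge0 f : (forall x, 0 <= f x) -> 0 <= mean f.
Proof. by move=> f0; apply: Rintegral_ge0. Qed.

Lemma meanE f : intble f -> (\int[P]_x (f x)%:E)%E = (mean f)%:E.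
Proof. by move=> If; rewrite /mean /Rintegral fineK//; exact: integrable_fin_num. Qed.

End mean.

Section normal_moments.
Context {R : realType}.
Local Notation mu := (@lebesgue_measure R).
Local Notation nu := (normal_prob (0 : R) 1).
Local Open Scope ereal_scope.

Lemma ge0_integral_normal (f : R -> \bar R) : measurable_fun setT f ->
  (forall x, 0 <= f x) ->
  \int[nu]_x f x = \int[mu]_x (f x * (normal_pdf 0 1 x)%:E).
Proof.
move=> mf f0; have dom : nu `<< mu := normal_prob_dominates 0 1.
rewrite -(Radon_Nikodym_SigmaFinite.change_of_variables dom)//=.
have mN : measurable_fun setT (fun x : R => (normal_pdf 0 1 x)%:E).
  by apply/measurable_EFinP; exact: measurable_normal_pdf.
have iR := Radon_Nikodym_SigmaFinite.f_integrable dom.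
apply: ae_eq_integral => //.
- by apply: emeasurable_funM => //; exact: measurable_int iR.
- exact: emeasurable_funM.
- apply: ae_eqe_mul2l; apply: integral_ae_eq => //.
  move=> E ET mE; rewrite -Radon_Nikodym_SigmaFinite.f_integral//.
Qed.

(** Up to the factor [a^-1], the integrand times the density is the density of
    standard deviation [a^-1].  The values [a < 1] give integrability, and
    letting [a] tend to 1 from both sides gives the variance. *)
Lemma normal_exp_square (a : R) : (0 < a)%R ->
  \int[nu]_x (expR ((1 - a ^+ 2) / 2 * x ^+ 2))%:E = (a^-1)%:E.
Proof.
move=> a0; rewrite ge0_integral_normal; last 2 first.
- apply/measurable_EFinP; apply: measurableT_comp => //.
  by apply: measurable_funM => //; exact: measurable_funX.
- by move=> x; rewrite lee_fin expR_ge0.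
transitivity (\int[mu]_x ((a^-1)%:E * (normal_pdf 0 a^-1 x)%:E)).
  apply: eq_integral => x _; rewrite -!EFinM; congr EFin.
  have an : a^-1%R != 0%R by rewrite invr_eq0 gt_eqF.
  rewrite !normal_pdfE ?oner_eq0//= /normal_peak /normal_fun !subr0.
  rewrite mulrCA -expRD [RHS]mulrA; congr (_ * expR _)%R; last first.
    by field; rewrite gt_eqF.
  rewrite -[in RHS]mulrnAr sqrtrM ?sqr_ge0// sqrtr_sqr gtr0_norm ?invr_gt0//.
  by rewrite invfM invrK mulKf ?gt_eqF// expr1n mul1r.
rewrite ge0_integralZl//.
- by rewrite integral_normal_pdf mule1.
- by apply/measurable_EFinP; exact: measurable_normal_pdf.
- by move=> x _; rewrite lee_fin normal_pdf_ge0.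
- by rewrite lee_fin invr_ge0 ltW.
Qed.

(** Completing the square, the integrand times the density is a multiple of
    the density centered at [t]. *)
Lemma normal_exp_linear (t : R) :
  \int[nu]_x (expR (t * x))%:E = (expR (t ^+ 2 / 2))%:E.
Proof.
have mt : measurable_fun setT (fun x : R => expR (t * x)).
  by apply: measurableT_comp => //; exact: mulrl_measurable.
rewrite ge0_integral_normal; last 2 first.
- exact/measurable_EFinP.
- by move=> x; rewrite lee_fin expR_ge0.
transitivity (\int[mu]_x ((expR (t ^+ 2 / 2))%:E * (normal_pdf t 1 x)%:E)).
  apply: eq_integral => x _; rewrite -!EFinM; congr EFin.
  rewrite !normal_pdfE ?oner_eq0//= /normal_fun.
  rewrite mulrCA [in RHS]mulrCA -!expRD; congr (_ * expR _)%R.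
  by field.
rewrite ge0_integralZl//.
- by rewrite integral_normal_pdf mule1.
- by apply/measurable_EFinP; exact: measurable_normal_pdf.
- by move=> x _; rewrite lee_fin normal_pdf_ge0.
Qed.

Local Close Scope ereal_scope.

Let mexp (c : R) (f : R -> R) : measurable_fun setT f ->
  measurable_fun setT (fun x : R => expR (c * f x)).
Proof.
move=> mf; apply: measurableT_comp => //.
by apply: measurableT_comp; [exact: mulrl_measurable|].
Qed.

Lemma normal_intble_exp_square (a : R) : 0 < a ->
  intble nu (fun x => expR ((1 - a ^+ 2) / 2 * x ^+ 2)).
Proof.
move=> a0; apply: intble_ge0 => [|x|]; [exact: mexp|exact: expR_ge0|].
by rewrite normal_exp_square// ltry.
Qed.

Lemma normal_intble_exp_linear (t : R) : intble nu (fun x => expR (t * x)).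
Proof.
apply: intble_ge0 => [|x|]; [exact: mexp|exact: expR_ge0|].
by rewrite normal_exp_linear ltry.
Qed.

(** The exponential [exp (2 u)], with [u = 3 x^2 / 16], is integrable by
    [normal_exp_square] at [a = 1/2], and it dominates [u^2]. *)
Lemma normal_intble_pow4 : intble nu (fun x => x ^+ 4).
Proof.
have h : 0 < 2^-1 :> R by lra.
apply: intble_dom (intbleZ ((16 / 3) ^+ 2) (normal_intble_exp_square h)) _.
  exact: measurable_funX.
move=> x; rewrite ger0_norm; last by rewrite (_ : 4%N = 2 * 2)%N// exprM sqr_ge0.
have := expR_ge1Dx (3 / 16 * x ^+ 2).
have := sqr_ge0 x; set u := x ^+ 2 => u0.
have -> : x ^+ 4 = u ^+ 2 by rewrite /u -exprM.
have -> : (1 - 2^-1 ^+ 2) / 2 * u = 3 / 16 * u + 3 / 16 * u by field.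
rewrite expRD; set e := expR _ => eu.
have : 3 / 16 * u <= e by lra.
move=> ue; have : (3 / 16 * u) * (3 / 16 * u) <= e * e by apply: ler_pM => //; lra.
rewrite !expr2; lra.
Qed.

Lemma normal_intble_dom (f : R -> R) : measurable_fun setT f ->
  (forall x, `|f x| <= 1 + x ^+ 4) -> intble nu f.
Proof.
move=> mf fx; apply: (@intble_dom _ _ _ nu f (fun x => 1 + x ^+ 4)) => //.
by apply: intbleD; [exact: intble_cst|exact: normal_intble_pow4].
Qed.

Lemma normal_intble_sqr : intble nu (fun x => x ^+ 2).
Proof.
apply: normal_intble_dom => [|x]; first exact: measurable_funX.
rewrite ger0_norm ?sqr_ge0// (_ : 4%N = 2 * 2)%N// exprM.
have := sqr_ge0 (x ^+ 2 - 1); have := sqr_ge0 x; nra.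
Qed.

Lemma normal_intble_id : intble nu (fun x => x).
Proof.
apply: normal_intble_dom => // x.
rewrite (_ : 4%N = 2 * 2)%N// exprM.
have h1 := sqr_ge0 (x ^+ 2 - 1); have h2 := sqr_ge0 (x - 1); have h3 := sqr_ge0 (x + 1).
rewrite ler_norml; apply/andP; split; nra.
Qed.

Let normal_sqr_ineq (a : R) : 0 < a ->
  (1 - a ^+ 2) / 2 * mean nu (fun x => x ^+ 2) + 1 <= a^-1.
Proof.
move=> a0; have I2 := normal_intble_sqr.
have Ie := normal_intble_exp_square a0.
have <- : mean nu (fun x => expR ((1 - a ^+ 2) / 2 * x ^+ 2)) = a^-1.
  by apply: EFin_inj; rewrite -meanE ?normal_exp_square.
rewrite -meanZ// -[X in _ + X](mean_cst nu) -meanD; last 2 first.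
- exact: intbleZ.
- exact: intble_cst.
apply: mean_le => //; first by apply: intbleD; [exact: intbleZ|exact: intble_cst].
by move=> x; rewrite addrC; exact: expR_ge1Dx.
Qed.

(** Integrating [1 + u <= exp u], for the exponent [u] of [normal_exp_square],
    shows that [a (1 + a)] times the second moment is at most 2 for [a < 1]
    and at least 2 for [a > 1]. *)
Lemma normal_mean_sqr : mean nu (fun x => x ^+ 2) = 1.
Proof.
have E0 : 0 <= mean nu (fun x => x ^+ 2) by apply: mean_ge0 => x; exact: sqr_ge0.
have H (a : R) : 0 < a -> (1 - a) * (a * (1 + a) * mean nu (fun x => x ^+ 2) - 2) <= 0.
  move=> a0; have := normal_sqr_ineq a0; rewrite -(ler_pM2r a0) mulVf ?gt_eqF//.
  set E := mean _ _ => h; lra.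
move: H E0; set E := mean _ _ => H E0.
apply/eqP; rewrite eq_le; apply/andP; split; rewrite leNgt; apply/negP => E1.
- pose t := Num.min 2^-1 ((E - 1) / (3 * E)).
  have E3 : 0 < 3 * E by lra.
  have t0 : 0 < t by rewrite lt_min invr_gt0 ltr0n divr_gt0// subr_gt0.
  have t1 : t <= 2^-1 by rewrite ge_min lexx.
  have t2 : 3 * E * t <= E - 1 by rewrite mulrC -ler_pdivlMr// ge_min lexx orbT.
  have a0 : 0 < 1 - t by lra.
  have := H _ a0; rewrite (_ : 1 - (1 - t) = t); last by ring.
  rewrite pmulr_rle0// => h.
  have : 0 <= t ^+ 2 * E by rewrite mulr_ge0// sqr_ge0.
  move: h t2; lra.
- pose t := Num.min 1 ((1 - E) / 5).
  have t0 : 0 < t by rewrite lt_min ltr01 divr_gt0// subr_gt0.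
  have t1 : t <= 1 by rewrite ge_min lexx.
  have t2 : t <= (1 - E) / 5 by rewrite ge_min lexx orbT.
  have a0 : 0 < 1 + t by lra.
  have := H _ a0; rewrite (_ : 1 - (1 + t) = - t); last by ring.
  rewrite mulNr oppr_le0 pmulr_rge0// => h.
  have : t ^+ 2 <= t by rewrite expr2 ler_piMl// ltW.
  nra.
Qed.

Let normal_lin_ineq (t : R) : t * mean nu (fun x => x) + 1 <= expR (t ^+ 2 / 2).
Proof.
have I1 := normal_intble_id.
have Ie := normal_intble_exp_linear t.
have <- : mean nu (fun x => expR (t * x)) = expR (t ^+ 2 / 2).
  by apply: EFin_inj; rewrite -meanE ?normal_exp_linear.
rewrite -meanZ// -[X in _ + X](mean_cst nu) -meanD; last 2 first.
- exact: intbleZ.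
- exact: intble_cst.
apply: mean_le => //; first by apply: intbleD; [exact: intbleZ|exact: intble_cst].
by move=> x; rewrite addrC; exact: expR_ge1Dx.
Qed.

(** Integrating [1 + t x <= exp (t x)] bounds [t] times the mean by [t^2] for
    small [t] of either sign. *)
Lemma normal_mean_id : mean nu (fun x => x) = 0.
Proof.
set E := mean _ _.
have H (t : R) : `|t| <= 1 -> t * E <= t ^+ 2.
  move=> t1; have := normal_lin_ineq t; rewrite -/E.
  have s1 : t ^+ 2 <= 1 by rewrite -real_normK ?num_real// expr_le1.
  have s0 := sqr_ge0 t.
  have := expR_ge1Dx (- (t ^+ 2 / 2)); rewrite expRN.
  set e := expR _ => h1 h2.
  have e0 : 0 < e by exact: expR_gt0.
  have : (1 - t ^+ 2 / 2) * e <= 1 by rewrite -ler_pdivlMr// div1r.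
  nra.
apply/eqP; rewrite eq_le; apply/andP; split; rewrite leNgt; apply/negP => E1.
- pose t := Num.min 1 (E / 2).
  have t0 : 0 < t by rewrite lt_min ltr01 divr_gt0.
  have t1 : t <= 1 by rewrite ge_min lexx.
  have t2 : t <= E / 2 by rewrite ge_min lexx orbT.
  have /H : `|t| <= 1 by rewrite gtr0_norm.
  rewrite expr2 ler_pM2l//; lra.
- pose t := Num.min 1 (- E / 2).
  have t0 : 0 < t by rewrite lt_min ltr01 divr_gt0// oppr_gt0.
  have t1 : t <= 1 by rewrite ge_min lexx.
  have t2 : t <= - E / 2 by rewrite ge_min lexx orbT.
  have /H : `|- t| <= 1 by rewrite normrN gtr0_norm.
  rewrite sqrrN mulNr -mulrN expr2 ler_pM2l//; lra.
Qed.

End normal_moments.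

(** * Laws and independence *)

Section laws.
Context d1 d2 (T : measurableType d1) (S : measurableType d2) (R : realType).
Variables (P : probability T R) (phi : T -> S) (mu : probability S R).

Definition law := measurable_fun setT phi /\
  forall A, measurable A -> P (phi @^-1` A) = mu A.

Hypothesis lphi : law.

Lemma law_ge0_integral (f : S -> \bar R) : measurable_fun setT f ->
  (forall x, 0 <= f x)%E ->
  (\int[P]_t f (phi t) = \int[mu]_x f x)%E.
Proof.
case: lphi => mphi lE mf f0.
transitivity (\int[pushforward P phi]_x f x)%E.
  by rewrite ge0_integral_pushforward// preimage_setT.
by apply: eq_measure_integral => A mA _; exact: lE.
Qed.

Lemma law_intble (f : S -> R) : intble mu f -> intble P (fun t => f (phi t)).
Proof.
case: (lphi) => mphi lE If; have mf := intble_meas If.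
apply/integrableP; split.
  by apply/measurable_EFinP; exact: (measurableT_comp mf mphi).
rewrite (law_ge0_integral (f := fun x => `|(f x)%:E|%E)) => [|//|//].
- by move/integrableP : If => [].
- apply: measurableT_comp => //; exact/measurable_EFinP.
Qed.

Lemma intble_law (f : S -> R) : measurable_fun setT f ->
  intble P (fun t => f (phi t)) -> intble mu f.
Proof.
move=> mf /integrableP[_ fy]; apply/integrableP; split; first exact/measurable_EFinP.
rewrite -(law_ge0_integral (f := fun x => `|(f x)%:E|%E)) => [//||//].
by apply: measurableT_comp => //; exact/measurable_EFinP.
Qed.

Lemma law_mean (f : S -> R) : intble mu f -> mean P (fun t => f (phi t)) = mean mu f.
Proof.
case: (lphi) => mphi lE If; have mf := intble_meas If; have If' := law_intble If.
apply: EFin_inj; rewrite -!meanE//.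
transitivity (\int[pushforward P phi]_x (f x)%:E)%E.
  by rewrite integral_pushforward//; exact/measurable_EFinP.
by apply: eq_measure_integral => A mA _; exact: lE.
Qed.

End laws.

Section independence.
Context d d1 d2 (T : measurableType d) (S1 : measurableType d1)
  (S2 : measurableType d2) (R : realType).
Variables (P : probability T R) (U : T -> S1) (V : T -> S2).
Variables (mu : probability S1 R) (nu : probability S2 R).
Hypotheses (mU : measurable_fun setT U) (mV : measurable_fun setT V).
Hypothesis UV : forall A B, measurable A -> measurable B ->
  (P (U @^-1` A `&` V @^-1` B) = mu A * nu B)%E.

Lemma law_pair : law P (fun t => (U t, V t)) (mu \x nu)%E.
Proof.
have mW : measurable_fun setT (fun t => (U t, V t)) by exact: measurable_fun_pair.
split => // A mA.
apply/esym.
exact: (@product_measure_unique _ _ _ _ _ mu nu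
  (pushforward P (fun t => (U t, V t)))).
Qed.

Lemma prod_intble (f : S1 -> R) (g : S2 -> R) : intble mu f -> intble nu g ->
  intble (mu \x nu)%E (fun z => f z.1 * g z.2).
Proof.
move=> If Ig.
have mf := intble_meas If; have mg := intble_meas Ig.
have mh : measurable_fun setT (fun z : S1 * S2 => f z.1 * g z.2).
  by apply: measurable_funM; exact: measurableT_comp.
apply/(@integrable12ltyP _ _ _ _ _ mu nu (fun z => (f z.1 * g z.2)%:E)).
  exact/measurable_EFinP.
have nf : intble mu (fun x => `|f x|) by exact: integrable_norm If.
have ng : intble nu (fun x => `|g x|) by exact: integrable_norm Ig.
rewrite (eq_integral (fun x => (mean nu (fun y => `|g y|) * `|f x|)%:E)) => [|x _].
  by rewrite meanE ?ltry//; exact: intbleZ.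
rewrite mulrC -meanZ// -meanE; last exact: intbleZ.
by apply: eq_integral => y _; rewrite /= normrM.
Qed.

Lemma prod_mean (f : S1 -> R) (g : S2 -> R) : intble mu f -> intble nu g ->
  mean (mu \x nu)%E (fun z => f z.1 * g z.2) = mean mu f * mean nu g.
Proof.
move=> If Ig; have Ih := prod_intble If Ig.
apply: EFin_inj; rewrite -meanE//.
rewrite -integral12_prod_meas1//=.
transitivity (\int[mu]_x (mean nu g * f x)%:E)%E.
  apply: eq_integral => x _; rewrite [in RHS]mulrC -meanZ// -meanE//.
  exact: intbleZ.
by rewrite meanE; [rewrite meanZ// mulrC|exact: intbleZ].
Qed.

Lemma indep_intble (f : S1 -> R) (g : S2 -> R) : intble mu f -> intble nu g ->
  intble P (fun t => f (U t) * g (V t)).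
Proof. by move=> If Ig; exact: (law_intble law_pair (prod_intble If Ig)). Qed.

Lemma indep_mean (f : S1 -> R) (g : S2 -> R) : intble mu f -> intble nu g ->
  mean P (fun t => f (U t) * g (V t)) = mean mu f * mean nu g.
Proof.
move=> If Ig.
by rewrite -prod_mean// -(law_mean law_pair (prod_intble If Ig)).
Qed.

End independence.

(** * Moments of the standard Gaussian vector *)

Section measurable_matrix_functions.
Context d (T : measurableType d) (R : realType).

Lemma measurable_entryf m n (F : T -> 'M[R]_(m, n)) i j : measurable_fun setT F ->
  measurable_fun setT (fun t => F t i j).
Proof. by move=> mF; exact: (measurableT_comp (measurable_entry i j) mF). Qed.

Lemma measurable_mulmx m n p (F : T -> 'M[R]_(m, n)) (G : T -> 'M[R]_(n, p)) :
  measurable_fun setT F -> measurable_fun setT G ->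
  measurable_fun setT (fun t => F t *m G t).
Proof.
move=> mF mG; apply: measurable_fun_matrix => i j.
under eq_fun do rewrite mxE.
by apply: measurable_sum => k; apply: measurable_funM; exact: measurable_entryf.
Qed.

Lemma measurable_mxD m n (F G : T -> 'M[R]_(m, n)) :
  measurable_fun setT F -> measurable_fun setT G ->
  measurable_fun setT (fun t => F t + G t).
Proof.
move=> mF mG; apply: measurable_fun_matrix => i j.
under eq_fun do rewrite mxE.
by apply: measurable_funD; exact: measurable_entryf.
Qed.

Lemma measurable_mxT m n (F : T -> 'M[R]_(m, n)) :
  measurable_fun setT F -> measurable_fun setT (fun t => (F t)^T).
Proof.
move=> mF; apply: measurable_fun_matrix => i j.
by under eq_fun do rewrite mxE; exact: measurable_entryf.
Qed.

Lemma measurable_mxB m n (F G : T -> 'M[R]_(m, n)) :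
  measurable_fun setT F -> measurable_fun setT G ->
  measurable_fun setT (fun t => F t - G t).
Proof.
move=> mF mG; apply: measurable_mxD => //; apply: measurable_fun_matrix => i j.
under eq_fun do rewrite mxE.
by apply: measurableT_comp => //; exact: measurable_entryf.
Qed.

Lemma measurable_fsq m n (F : T -> 'M[R]_(m, n)) :
  measurable_fun setT F -> measurable_fun setT (fun t => fsq (F t)).
Proof.
move=> mF; under eq_fun do rewrite fsqE.
apply: measurable_sum => j; apply: measurable_sum => i.
by apply: measurable_funX; exact: measurable_entryf.
Qed.

End measurable_matrix_functions.

Section gauss_moments.
Context {R : realType} (d : nat).
Local Notation nu := (normal_prob (0 : R) 1).
Local Notation G := (@std_gauss R d).

Lemma std_gauss_coord j : law G (fun v => v j 0 : measurableTypeR R) nu.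
Proof.
split; first by move=> _ A mA; exact: (measurable_entry j 0).
move=> A mA; pose B i := if i == j then A else setT.
have mB i : measurable (B i) by rewrite /B; case: ifP.
have -> : (fun v : 'cV[R]_d => v j 0 : measurableTypeR R) @^-1` A =
    [set v | forall i, B i (v i 0)].
  apply/seteqP; split=> v /= h => [i|]; rewrite /B; last by have := h j; rewrite /B eqxx.
  by case: eqP => // ->.
rewrite std_gauss_box// (bigD1 j)//= {1}/B eqxx big1 ?mule1// => i ij.
by rewrite /B (negbTE ij); exact: probability_setT.
Qed.

Lemma std_gauss_coord2 j k (A B : set (measurableTypeR R)) : j != k ->
  measurable A -> measurable B ->
  G ((fun v => v j 0 : measurableTypeR R) @^-1` A `&`
     (fun v => v k 0 : measurableTypeR R) @^-1` B) = (nu A * nu B)%E.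
Proof.
move=> jk mA mB; pose C i := if i == j then A else if i == k then B else setT.
have mC i : measurable (C i) by rewrite /C; case: ifP => // _; case: ifP.
rewrite (_ : _ `&` _ = [set v | forall i, C i (v i 0)]); last first.
  apply/seteqP; split=> v /= => [[hA hB] i|h].
    by rewrite /C; case: eqP => [->//|_]; case: eqP => // ->.
  split; first by have := h j; rewrite /C eqxx.
  by have := h k; rewrite /C eq_sym (negbTE jk) eqxx.
rewrite std_gauss_box// (bigD1 j)//= (bigD1 k)/=; last by rewrite eq_sym.
rewrite {1}/C eqxx {1}/C eq_sym (negbTE jk) eqxx big1 ?mule1// => i /andP[ij ik].
by rewrite /C (negbTE ij) (negbTE ik); exact: probability_setT.
Qed.

Lemma std_gauss_intble_coord j : intble G (fun v => v j 0).
Proof. exact: (law_intble (std_gauss_coord j) (@normal_intble_id R)). Qed.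

Lemma std_gauss_intble_sqr j : intble G (fun v => v j 0 ^+ 2).
Proof. exact: (law_intble (std_gauss_coord j) (@normal_intble_sqr R)). Qed.

Lemma std_gauss_intble_pow4 j : intble G (fun v => v j 0 ^+ 4).
Proof. exact: (law_intble (std_gauss_coord j) (@normal_intble_pow4 R)). Qed.

Lemma std_gauss_mean_coord j : mean G (fun v => v j 0) = 0.
Proof.
by rewrite (law_mean (std_gauss_coord j) (@normal_intble_id R)) normal_mean_id.
Qed.

Lemma std_gauss_intble_prod j k : intble G (fun v => v j 0 * v k 0).
Proof.
apply: intble_dom (intbleD (std_gauss_intble_sqr j) (std_gauss_intble_sqr k)) _.
  by apply: measurable_funM; exact: measurable_entry.
move=> v; have := sqr_ge0 (v j 0 - v k 0); have := sqr_ge0 (v j 0 + v k 0).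
rewrite ler_norml => h1 h2; apply/andP; split; nra.
Qed.

Lemma std_gauss_mean_prod j k : mean G (fun v => v j 0 * v k 0) = (j == k)%:R.
Proof.
have [<-|jk] := eqVneq j k.
  under eq_fun do rewrite -expr2.
  by rewrite (law_mean (std_gauss_coord j) (@normal_intble_sqr R)) normal_mean_sqr.
have [m1 _] := std_gauss_coord j; have [m2 _] := std_gauss_coord k.
have H := indep_mean m1 m2 (fun A B => std_gauss_coord2 jk).
by rewrite (H _ _ (@normal_intble_id R) (@normal_intble_id R)) normal_mean_id mul0r.
Qed.

Lemma std_gauss_intble_fsq : intble G (fun v => fsq v).
Proof.
under eq_fun do rewrite fsqE.
apply: intble_sum => j; apply: intble_sum => i; rewrite ord1.
exact: std_gauss_intble_sqr.
Qed.

Definition outer_dev (v : 'cV[R]_d) : 'M[R]_d := v *m v^T - 1%:M.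

Lemma outer_devE v i j : outer_dev v i j = v i 0 * v j 0 - (i == j)%:R.
Proof. by rewrite !mxE big_ord1 !mxE. Qed.

Lemma std_gauss_outer_dev i j :
  intble G (fun v => outer_dev v i j) /\ mean G (fun v => outer_dev v i j) = 0.
Proof.
under eq_fun do rewrite outer_devE.
split; first by apply: intbleD; [exact: std_gauss_intble_prod|exact: intble_cst].
rewrite meanD; [|exact: std_gauss_intble_prod|exact: intble_cst].
by rewrite mean_cst std_gauss_mean_prod subrr.
Qed.

Lemma std_gauss_intble_outer : intble G (fun v => fsq (outer_dev v)).
Proof.
under eq_fun do rewrite fsqE.
apply: intble_sum => j; apply: intble_sum => i.
have I4 := intbleD (std_gauss_intble_pow4 i) (std_gauss_intble_pow4 j).
apply: intble_dom (intbleD I4 (intble_cst _ 2)) _.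
  apply: measurable_funX; exact: intble_meas (std_gauss_outer_dev i j).1.
move=> v; rewrite ger0_norm ?sqr_ge0// outer_devE.
have b01 : ((i == j)%:R : R) ^+ 2 <= 1 by case: (i == j); rewrite ?expr0n ?expr1n.
have e4 (x : R) : x ^+ 4 = (x ^+ 2) ^+ 2 by rewrite -exprM.
rewrite !e4.
have h1 := sqr_ge0 (v i 0 ^+ 2 - v j 0 ^+ 2).
have h2 := sqr_ge0 (v i 0 * v j 0 + (i == j)%:R).
nra.
Qed.

End gauss_moments.

(** * Centered random matrices and the synchronous coupling *)

Definition centered d (T : measurableType d) (R : realType) (P : probability T R)
  m n (F : T -> 'M[R]_(m, n)) (K : R) : Prop :=
  [/\ measurable_fun setT F,
      forall i j, intble P (fun t => F t i j) /\ mean P (fun t => F t i j) = 0,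
      intble P (fun t => fsq (F t)) & mean P (fun t => fsq (F t)) <= K].

Section gauss_centered.
Context {R : realType} (d : nat).
Local Notation G := (@std_gauss R d).

Definition mean_fsq : R := mean G (fun v => fsq v).
Definition mean_fsq_outer : R := mean G (fun v => fsq (outer_dev v)).

Lemma centered_law d1 d2 (T : measurableType d1) (S : measurableType d2)
    (P : probability T R) (mu : probability S R) (phi : T -> S) m n
    (F : S -> 'M[R]_(m, n)) K : law P phi mu -> measurable_fun setT F ->
  centered P (fun t => F (phi t)) K -> centered mu F K.
Proof.
move=> lphi mF [_ Fij I2 E2].
have mf : measurable_fun setT (fun x => fsq (F x)) by exact: measurable_fsq.
have If := intble_law lphi mf I2.
split => //; last by rewrite -(law_mean lphi If).
move=> i j; have [Iij Eij] := Fij i j.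
have Ig : intble mu (fun x => F x i j).
  by apply: (intble_law lphi) => //; exact: measurable_entryf.
by split => //; rewrite -(law_mean lphi Ig).
Qed.

Lemma centered_mul d1 (T : measurableType d1) (P : probability T R) m n p q
    (F : T -> 'M[R]_(m, n)) (A : 'M[R]_(p, m)) (B : 'M[R]_(n, q)) K :
  centered P F K -> centered P (fun t => A *m F t *m B) (fsq A * K * fsq B).
Proof.
move=> [mF Fij I2 E2].
have mG : measurable_fun setT (fun t => A *m F t *m B).
  by do 2!apply: measurable_mulmx => //; exact: measurable_cst.
have le2 t : fsq (A *m F t *m B) <= (fsq A * fsq B) * fsq (F t).
  rewrite (le_trans (fsq_mulmx _ _))// mulrAC ler_wpM2r// fsq_mulmx//.
have IG : intble P (fun t => fsq (A *m F t *m B)).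
  apply: intble_dom (intbleZ (fsq A * fsq B) I2) _; first exact: measurable_fsq.
  by move=> t; rewrite ger0_norm.
split => //.
- move=> i j.
  have E : (fun t => (A *m F t *m B) i j) =
      (fun t => \sum_k \sum_l (A i l * B k j) * F t l k).
    apply/funext => t; rewrite mxE; apply: eq_bigr => k _.
    by rewrite mxE mulr_suml; apply: eq_bigr => l _; rewrite mulrAC.
  have I1 k l : intble P (fun t => (A i l * B k j) * F t l k).
    by apply: intbleZ; have [] := Fij l k.
  rewrite E; split; first by apply: intble_sum => k; exact: intble_sum.
  rewrite mean_sum; last by move=> k; exact: intble_sum.
  rewrite big1// => k _; rewrite mean_sum//.
  rewrite big1// => l _; rewrite meanZ; last by have [] := Fij l k.
  by have [_ ->] := Fij l k; rewrite mulr0.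
- apply: le_trans (_ : mean P (fun t => (fsq A * fsq B) * fsq (F t)) <= _).
    by apply: mean_le => //; exact: intbleZ.
  by rewrite meanZ// [leRHS]mulrAC ler_wpM2l ?mulr_ge0.
Qed.

Lemma law_affv (m : 'cV[R]_d) (s : 'M[R]_d) :
  law G (affv m (sqrtmx s)) (gauss m s).
Proof. by split => //; exact: measurable_funP. Qed.

Lemma std_gauss_centered : centered G (fun v : 'cV[R]_d => v) mean_fsq.
Proof.
split => //; last exact: std_gauss_intble_fsq.
move=> i j; rewrite ord1; split; first exact: std_gauss_intble_coord.
exact: std_gauss_mean_coord.
Qed.

Lemma std_gauss_outer_centered : centered G (@outer_dev R d) mean_fsq_outer.
Proof.
split => //; last exact: std_gauss_intble_outer.
  apply: measurable_mxB; last exact: measurable_cst.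
  by apply: measurable_mulmx => //; exact: measurable_mxT.
by move=> i j; exact: std_gauss_outer_dev.
Qed.

Lemma gauss_centered (m : 'cV[R]_d) (s : 'M[R]_d) :
  centered (gauss m s) (fun x => x - m) (fsq (sqrtmx s) * mean_fsq).
Proof.
apply: (centered_law (law_affv m s)).
  by apply: measurable_mxB => //; exact: measurable_cst.
have := centered_mul (sqrtmx s) 1%:M std_gauss_centered.
rewrite fsq1 mulr1; congr (centered _ _ _).
by apply/funext => v; rewrite /affv mulmx1 addrC addKr.
Qed.

(** With [x - m = s^(1/2) z], the matrix is the congruence of [z z^T - 1] by
    [s^(1/2)]. *)
Lemma gauss_outer_centered (m : 'cV[R]_d) (s : 'M[R]_d) : psdmx s ->
  centered (gauss m s) (fun x => (x - m) *m (x - m)^T - s)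
    (fsq (sqrtmx s) * mean_fsq_outer * fsq (sqrtmx s)).
Proof.
move=> ps; apply: (centered_law (law_affv m s)).
  have mx : measurable_fun setT (fun x : 'cV[R]_d => x - m).
    by apply: measurable_mxB => //; exact: measurable_cst.
  apply: measurable_mxB; last exact: measurable_cst.
  by apply: measurable_mulmx => //; exact: measurable_mxT.
have := centered_mul (sqrtmx s) (sqrtmx s) std_gauss_outer_centered.
congr (centered _ _ _); apply/funext => v.
have -> : affv m (sqrtmx s) v - m = sqrtmx s *m v by rewrite /affv addrC addKr.
rewrite /outer_dev mulmxBr mulmxBl mulmx1 sqrtmxK//.
by rewrite trmx_mul sqrtmx_sym// !mulmxA.
Qed.

End gauss_centered.

Section coupling_bound.
Context {R : realType} (d : nat).
Local Notation G := (@std_gauss R d).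

(** The map whose image of two independent standard Gaussian vectors has the
    law of the bridge ([law_bridge_map]). *)
Definition bridge_map (chi : 'M[R]_d) m s n k (zg : 'cV[R]_d * 'cV[R]_d) :=
  let x := affv m (sqrtmx s) zg.1 in
  (x, n + k *m chi *m (x - m) + sqrtmx k *m zg.2).

Lemma measurable_bridge_map chi m s n k :
  measurable_fun setT (bridge_map chi m s n k).
Proof.
have m1 : measurable_fun setT (fun zg : 'cV[R]_d * 'cV[R]_d => affv m (sqrtmx s) zg.1).
  by apply: measurableT_comp => //; exact: measurable_funP.
apply: measurable_fun_pair => //.
apply: measurable_addmx; last exact: measurable_mulmxl.
apply: measurable_addmx; first exact: measurable_cst.
by apply: measurable_mulmxl; apply: measurable_mxB.
Qed.

Lemma law_bridge_map (chi : 'M[R]_d) m s n k :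
  law (G \x G)%E (bridge_map chi m s n k)
    (semidirect (gauss m s) (bridge_kernel chi m n k)).
Proof.
have mB := measurable_bridge_map chi m s n k.
split => // A mA.
have mBA : measurable (bridge_map chi m s n k @^-1` A).
  by rewrite -[X in measurable X]setTI; exact: mB.
rewrite -[RHS]/(\int[gauss m s]_x bridge_kernel chi m n k x (xsection A x))%E.
transitivity (\int[G]_z bridge_kernel chi m n k (affv m (sqrtmx s) z)
    (xsection A (affv m (sqrtmx s) z)))%E.
  apply: eq_integral => z _; set x := affv m _ z.
  have -> : bridge_kernel chi m n k x (xsection A x) =
      G (affv (n + k *m chi *m (x - m)) (sqrtmx k) @^-1` xsection A x) by [].
  rewrite /=; congr (G _); apply/seteqP; split=> g; rewrite /xsection/= !inE//.
apply: (law_ge0_integral (law_affv m s)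
  (f := fun x => bridge_kernel chi m n k x (xsection A x))) => [|x].
  by apply: measurable_fun_xsection_finite_kernel; rewrite inE.
exact: measure_ge0.
Qed.

(** The two bridge maps, evaluated at the same pair of Gaussian vectors, form a
    coupling; its cost is bounded with the convexity of the square. *)
Lemma wasserstein_bridge_le (chi : 'M[R]_d) m s n k m' s' n' k' :
  (wasserstein2 sqdist_pair
     (semidirect (gauss m s) (bridge_kernel chi m n k))
     (semidirect (gauss m' s') (bridge_kernel chi m' n' k')) ^+ 2 <=
   (3 * (1 + mean_fsq d) * (fsq (m - m') + fsq (n - n') + gap chi s k s' k'))%:E)%E.
Proof.
pose W zg := (bridge_map chi m s n k zg, bridge_map chi m' s' n' k' zg).
have mW : measurable_fun setT W.
  by apply: measurable_fun_pair; exact: measurable_bridge_map.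
pose Wf : {mfun _ >-> _} := HB.pack W (isMeasurableFun.Build _ _ _ _ _ mW).
pose Q := distribution (G \x G)%E Wf.
have lW : law (G \x G)%E W Q by split.
rewrite /wasserstein2 sqr_sqrte; last first.
  apply: le_ereal_inf_tmp => _ [p _ <-]; apply: integral_ge0 => z _.
  by rewrite lee_fin /sqdist_pair addr_ge0// sqr_ge0.
apply: (@le_trans _ _ (\int[Q]_z (sqdist_pair z.1 z.2)%:E)%E).
  apply: ereal_inf_lbound; exists Q => // A mA.
  have [_ l1] := law_bridge_map chi m s n k.
  have [_ l2] := law_bridge_map chi m' s' n' k'.
  split; [rewrite -l1//|rewrite -l2//]; rewrite /Q /distribution /pushforward;
    congr ((_ \x _)%E _).
  - by apply/seteqP; split=> z //= [].
  - by apply/seteqP; split=> z //= [].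
have cE : (fun z : ('cV[R]_d * 'cV[R]_d) * ('cV[R]_d * 'cV[R]_d) => sqdist_pair z.1 z.2) =
    (fun z => fsq (z.1.1 - z.2.1) + fsq (z.1.2 - z.2.2)).
  by apply/funext => z; rewrite /sqdist_pair !enormE !sqr_fnorm.
have mS : measurable_fun setT (fun z : ('cV[R]_d * 'cV[R]_d) * ('cV[R]_d * 'cV[R]_d) =>
    sqdist_pair z.1 z.2).
  rewrite cE; apply: measurable_funD; apply: measurable_fsq; apply: measurable_mxB.
  - by do 2!apply: measurableT_comp => //.
  - by do 2!apply: measurableT_comp => //.
  - by do 2!apply: measurableT_comp => //.
  - by do 2!apply: measurableT_comp => //.
rewrite -(law_ge0_integral lW (f := fun z => (sqdist_pair z.1 z.2)%:E)); last 2 first.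
- exact/measurable_EFinP.
- by move=> z; rewrite lee_fin /sqdist_pair addr_ge0// sqr_ge0.
set gA := fsq (sqrtmx s - sqrtmx s').
set gC := fsq (k *m chi *m sqrtmx s - k' *m chi *m sqrtmx s').
set gK := fsq (sqrtmx k - sqrtmx k').
pose f1 (z : 'cV[R]_d) : R := 3 * (fsq (m - m') + fsq (n - n')) + 3 * (gA + gC) * fsq z.
pose f2 (g : 'cV[R]_d) : R := 3 * gK * fsq g.
have If1 : intble G f1.
  by apply: intbleD; [exact: intble_cst|apply: intbleZ; exact: std_gauss_intble_fsq].
have If2 : intble G f2 by apply: intbleZ; exact: std_gauss_intble_fsq.
have I1 := prod_intble If1 (intble_cst G 1).
have I2 := prod_intble (intble_cst G 1) If2.
apply: (@le_trans _ _ (\int[(G \x G)%E]_z (f1 z.1 * 1 + 1 * f2 z.2)%:E)%E).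
  apply: ge0_le_integral => //=.
  - by move=> z _; rewrite lee_fin /sqdist_pair addr_ge0// sqr_ge0.
  - by apply/measurable_EFinP; exact: (measurableT_comp mS mW).
  - apply/measurable_EFinP; exact: intble_meas (intbleD I1 I2).
  move=> z _; rewrite lee_fin mulr1 mul1r.
  rewrite -[sqdist_pair _ _]/((fun z => sqdist_pair z.1 z.2) (W z)) cE /=.
  have -> : affv m (sqrtmx s) z.1 - affv m' (sqrtmx s') z.1 =
      (m - m') + (sqrtmx s - sqrtmx s') *m z.1.
    by rewrite /affv mulmxBl addrACA -opprD.
  have affvB q A (v : 'cV[R]_d) : affv q A v - q = A *m v by rewrite /affv addrC addKr.
  rewrite !affvB.
  set D := (X in _ + fsq X <= _).
  have -> : D = (n - n') + (k *m chi *m sqrtmx s - k' *m chi *m sqrtmx s') *m z.1 +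
      (sqrtmx k - sqrtmx k') *m z.2.
    by rewrite /D !mulmxBl -!mulmxA !opprD addrACA [X in X + _ = _]addrACA.
  have h1 := fsqD_le (m - m') ((sqrtmx s - sqrtmx s') *m z.1).
  have h2 := fsqD3_le (n - n')
    ((k *m chi *m sqrtmx s - k' *m chi *m sqrtmx s') *m z.1)
    ((sqrtmx k - sqrtmx k') *m z.2).
  have b1 := fsq_mulmx (sqrtmx s - sqrtmx s') z.1.
  have b2 := fsq_mulmx (k *m chi *m sqrtmx s - k' *m chi *m sqrtmx s') z.1.
  have b3 := fsq_mulmx (sqrtmx k - sqrtmx k') z.2.
  rewrite /f1 /f2.
  have c1 := fsq_ge0 (m - m'). have c2 : 0 <= gA * fsq z.1 by rewrite mulr_ge0.
  have e1 : 3 * (gA + gC) * fsq z.1 = 3 * (gA * fsq z.1) + 3 * (gC * fsq z.1) by ring.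
  have e2 : 3 * gK * fsq z.2 = 3 * (gK * fsq z.2) by ring.
  rewrite e1 e2; move: h1 h2 b1 b2 b3 c1 c2; rewrite -/gA -/gC -/gK; lra.
rewrite meanE ?lee_fin; last exact: intbleD I1 I2.
rewrite meanD// (prod_mean If1 (intble_cst G 1)) (prod_mean (intble_cst G 1) If2).
rewrite !mean_cst mulr1 mul1r /f1 /f2 meanD; last 2 first.
- exact: intble_cst.
- by apply: intbleZ; exact: std_gauss_intble_fsq.
rewrite !meanZ; try exact: std_gauss_intble_fsq.
rewrite mean_cst -/(mean_fsq d) /gap -/gA -/gC -/gK.
have M0 : 0 <= @mean_fsq R d by apply: mean_ge0 => v; exact: fsq_ge0.
have h1 := fsq_ge0 (m - m'); have h2 := fsq_ge0 (n - n').
have : 0 <= gA + gC + gK by rewrite !addr_ge0.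
have := mulr_ge0 M0 (addr_ge0 h1 h2); nra.
exact: intble_cst.
Qed.

End coupling_bound.

(** * Sums of independent copies and sample moments *)

(** The integral of a nonnegative function is a supremum over the simple
    functions below it.  So monotonicity extends to functions such as a
    Wasserstein distance depending on a parameter, an infimum over couplings
    whose measurability is not clear. *)
Lemma le_integral_nonmeasurable d (T : measurableType d) (R : realType)
    (mu : {measure set T -> \bar R}) (f g : T -> \bar R) :
  (forall x, 0 <= f x)%E -> (forall x, f x <= g x)%E ->
  (\int[mu]_x f x <= \int[mu]_x g x)%E.
Proof.
move=> f0 fg; have g0 x : (0 <= g x)%E by exact: le_trans (fg x).
rewrite !ge0_integralTE//; apply/ge_ereal_sup => /= _ [h hf <-].
by apply: ereal_sup_ubound; exists h => // x; exact: le_trans (hf x) (fg x).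
Qed.

Section iid_sums.
Context d d1 (T : measurableType d) (S : measurableType d1) (R : realType).
Variables (P : probability T R) (mu : probability S R) (n : nat).
Variable X : 'I_n -> T -> S.
Hypothesis lX : forall i, law P (X i) mu.
Hypothesis indX : forall i k, i != k -> forall A B, measurable A -> measurable B ->
  (P (X i @^-1` A `&` X k @^-1` B) = mu A * mu B)%E.

Lemma fdot_sumr p q (I : Type) (r : seq I) (A : 'M[R]_(p, q)) (B : I -> 'M[R]_(p, q)) :
  fdot A (\sum_(i <- r) B i) = \sum_(i <- r) fdot A (B i).
Proof.
elim: r => [|i r IH]; last by rewrite !big_cons fdotDr IH.
by rewrite !big_nil -(scale0r 0) fdotZr mul0r.
Qed.

Lemma fsq_sum p q (B : 'I_n -> 'M[R]_(p, q)) :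
  fsq (\sum_i B i) = \sum_i \sum_k fdot (B i) (B k).
Proof.
by rewrite /fsq fdot_sumr; apply: eq_bigr => i _; rewrite fdotC fdot_sumr.
Qed.

(** Expanding the square only involves pairs of indices, and the mixed terms
    have mean zero. *)
Lemma mean_fsq_sum p q (F : S -> 'M[R]_(p, q)) K : centered mu F K ->
  intble P (fun t => fsq (\sum_i F (X i t))) /\
  mean P (fun t => fsq (\sum_i F (X i t))) <= n%:R * K.
Proof.
move=> [mF Fij I2 E2].
have cross i k : intble P (fun t => fdot (F (X i t)) (F (X k t))) /\
    mean P (fun t => fdot (F (X i t)) (F (X k t))) <= (i == k)%:R * K.
  have [<-|ik] := eqVneq i k.
    have If := law_intble (lX i) I2; split => //.
    by rewrite mul1r (law_mean (lX i) I2).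
  rewrite mul0r; under eq_fun do rewrite fdotE.
  have Iab a b : intble P (fun t => F (X i t) b a * F (X k t) b a).
    have [mi _] := lX i; have [mk _] := lX k.
    by have := indep_intble mi mk (indX ik) (Fij b a).1 (Fij b a).1.
  split; first by apply: intble_sum => a; exact: intble_sum.
  rewrite mean_sum; last by move=> a; exact: intble_sum.
  rewrite big1// => a _; rewrite mean_sum// big1// => b _.
  have [mi _] := lX i; have [mk _] := lX k.
  rewrite (indep_mean mi mk (indX ik) (Fij b a).1 (Fij b a).1).
  by rewrite (Fij b a).2 mul0r.
under eq_fun do rewrite fsq_sum.
split; first by apply: intble_sum => i; apply: intble_sum => k; exact: (cross i k).1.
rewrite mean_sum; last by move=> i; apply: intble_sum => k; exact: (cross i k).1.
rewrite mulr_natl -[X in _ <= _ *+ X](card_ord n) -sumr_const; apply: ler_sum => i _.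
rewrite mean_sum; last by move=> k; exact: (cross i k).1.
apply: (@le_trans _ _ (\sum_k (i == k)%:R * K)).
  by apply: ler_sum => k _; exact: (cross i k).2.
rewrite (bigD1 i)//= eqxx mul1r big1 ?addr0// => k ki.
by rewrite eq_sym (negbTE ki) mul0r.
Qed.

End iid_sums.

(** Linear growth is what keeps the fourth moments of the sample mean out of
    the estimates; see [capped_sqr_le]. *)
Definition capped_sqr {R : realType} (x : R) : R := if x <= 1 then x ^+ 2 else x.

Lemma capped_sqr_ge0 (R : realType) (x : R) : 0 <= x -> 0 <= capped_sqr x.
Proof. by rewrite /capped_sqr; case: ifP => // _ _; exact: sqr_ge0. Qed.

(** If [t >= e] the square applies to [x <= 2 t], otherwise [x <= 2 e]. *)
Lemma capped_sqr_le (R : realType) (x t e : R) : 0 <= x -> 0 <= t -> 0 <= e ->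
  x <= t + e -> capped_sqr x <= 4 * t ^+ 2 + 2 * e.
Proof.
move=> x0 t0 e0 xte; rewrite /capped_sqr.
have [et|te] := leP e t.
  have x2 : x <= 2 * t by lra.
  have : x ^+ 2 <= (2 * t) ^+ 2 by rewrite ler_pXn2r ?nnegrE//; lra.
  rewrite exprMn; case: ifP => [_|/negbT]; first by nra.
  by rewrite -ltNge => x1; nra.
have x2 : x <= 2 * e by lra.
have t20 := sqr_ge0 t.
case: ifP => x1; last by lra.
have : x ^+ 2 <= x by rewrite expr2 ler_piMl.
lra.
Qed.

Section sample_error.
Context {R : realType} (d N : nat).
Implicit Types (x : 'I_N.+1 -> 'cV[R]_d) (m : 'cV[R]_d) (s : 'M[R]_d).

Lemma smean_centered x m : smean x - m = N.+1%:R^-1 *: \sum_i (x i - m).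
Proof.
rewrite sumrB sumr_const card_ord scalerBr /smean; congr (_ - _).
by rewrite -[m *+ _]scaler_nat scalerA mulVf ?scale1r// pnatr_eq0.
Qed.

Lemma scov_centered x m s : (0 < N)%N ->
  scov x - s = N%:R^-1 *: (\sum_i ((x i - m) *m (x i - m)^T - s) + s) -
    (N.+1%:R / N%:R) *: ((smean x - m) *m (smean x - m)^T).
Proof.
move=> N0; have Nn : N%:R != 0 :> R by rewrite pnatr_eq0 -lt0n.
pose y i := x i - m; pose u := smean x - m.
have uE : \sum_i y i = N.+1%:R *: u.
  by rewrite /u smean_centered scalerA divff ?scale1r// pnatr_eq0.
have E1 : \sum_i (x i - smean x) *m (x i - smean x)^T =
    \sum_i y i *m (y i)^T - N.+1%:R *: (u *m u^T).
  transitivity (\sum_i (y i *m (y i)^T - y i *m u^T - u *m (y i)^T + u *m u^T)).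
    apply: eq_bigr => i _; have -> : x i - smean x = y i - u.
      by rewrite /y /u opprB addrA subrK.
    rewrite [(_ - _)^T]linearB/= mulmxBl.
    by rewrite !mulmxBr opprB addrA addrAC.
  rewrite !big_split/= !sumrN -mulmx_suml -mulmx_sumr -linear_sum uE/=.
  rewrite linearZ/= -scalemxAl -scalemxAr sumr_const card_ord -[_ *m _ *+ _]scaler_nat.
  by rewrite subrK.
rewrite /scov E1 sumrB sumr_const card_ord scalerBr.
rewrite scalerA [N%:R^-1 * _]mulrC addrAC; congr (_ - _).
rewrite -addrA scalerDr; congr (_ + _).
rewrite -[s *+ _]scaler_nat -[X in _ + X]scale1r -scaleNr -scalerDl scalerA.
by rewrite -natr1 opprD addrNK mulrN mulVf// scaleN1r.
Qed.

Lemma psd_outer (u : 'cV[R]_d) : psdmx (u *m u^T).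
Proof.
split; first by rewrite /symmx trmx_mul trmxK.
move=> x; rewrite mulmxA -mulmxA.
have -> : x^T *m u = (u^T *m x)^T by rewrite trmx_mul trmxK.
by rewrite mxE big_ord1 mxE -expr2 sqr_ge0.
Qed.

Lemma psd_scov x : psdmx (scov x).
Proof.
have : psdmx (\sum_i (x i - smean x) *m (x i - smean x)^T).
  elim/big_ind : _ => [|A B|i _]; [|exact: psdmxD|exact: psd_outer].
  rewrite (_ : 0 = 0%:M); first exact: psdmx_scalar.
  by apply/matrixP => i j; rewrite !mxE mul0rn.
rewrite /scov; set A := \sum_i _ => -[sA qA]; split; first by rewrite /symmx linearZ/= sA.
by move=> z; rewrite -/(qform _ z) qformZ mulr_ge0// ?invr_ge0//; exact: qA.
Qed.

End sample_error.

(** * The two regimes, and the mean error of the sample moments *)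

(** Once one of the two errors exceeds 1, the capped squares dominate the
    linear bound of [gap_global]; otherwise [gap_local] applies with the bound
    [M + 1] on all four covariances. *)
Lemma gap_capped (R : realType) d (chi : 'M[R]_d) lo M :
  chi \in unitmx -> 0 < lo -> 0 <= M ->
  exists2 C, 0 <= C & forall s v s' v' e,
    psdmx s -> psdmx v -> psdmx s' -> psdmx v' ->
    (forall x, lo * fsq x <= qform s x) -> (forall x, lo * fsq x <= qform v x) ->
    fnorm s <= M -> fnorm v <= M -> 0 < e ->
    gap chi s (kappa chi s v) s' (kappa_eps chi e s' v') <=
    C * (capped_sqr (fnorm (s - s')) + capped_sqr (fnorm (v - v')) + e ^+ 2).
Proof.
move=> uc lo0 M0.
have M1 : 0 <= M + 1 by rewrite addr_ge0.
have [C1 C10 H1] := gap_local uc lo0 M1.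
have [C2 C20 H2] := gap_global uc M0.
exists (3 * C1 + 3 * C2); first by rewrite addr_ge0// mulr_ge0.
move=> s v s' v' e ps pv ps' pv' slo vlo sM vM e0.
have x0 := fnorm_ge0 (s - s'); have y0 := fnorm_ge0 (v - v').
have near (X X' : 'M[R]_d) : fnorm X <= M -> fnorm (X - X') <= 1 -> fnorm X' <= M + 1.
  move=> XM XX; have := fnormD X (X' - X); rewrite addrC subrK (fnormB X' X) => h.
  by rewrite (le_trans h)// lerD.
have wk (X : 'M[R]_d) : fnorm X <= M -> fnorm X <= M + 1.
  by move=> /le_trans; apply; rewrite lerDl.
have G2 := H2 s v s' v' e ps pv ps' pv' (unitmx_qform lo0 slo)
  (unitmx_qform lo0 vlo) sM vM e0.
have e20 := sqr_ge0 e.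
have far : (1 < fnorm (s - s')) || (1 < fnorm (v - v')) ->
    1 + fnorm (s - s') + fnorm (v - v') <=
    3 * (capped_sqr (fnorm (s - s')) + capped_sqr (fnorm (v - v'))).
  have sx := sqr_ge0 (fnorm (s - s')). have sy := sqr_ge0 (fnorm (v - v')).
  rewrite /capped_sqr; case: (leP (fnorm (s - s')) 1) => x1;
    case: (leP (fnorm (v - v')) 1) => y1 //= _; lra.
have P1 := capped_sqr_ge0 x0. have P2 := capped_sqr_ge0 y0.
have [fa|] := boolP ((1 < fnorm (s - s')) || (1 < fnorm (v - v'))).
  apply: (le_trans G2); have := ler_wpM2l C20 (far fa).
  set A := capped_sqr _ in P1 *; set B := capped_sqr _ in P2 *; move=> h.
  apply: (le_trans h).
  have q1 := mulr_ge0 C10 (addr_ge0 (addr_ge0 P1 P2) e20).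
  have q2 := mulr_ge0 C20 e20.
  nra.
rewrite negb_or -!leNgt => /andP[x1 y1].
rewrite /capped_sqr x1 y1.
have := H1 s v s' v' e ps pv ps' pv' slo vlo (wk _ sM) (wk _ vM)
  (near _ _ sM x1) (near _ _ vM y1) e0.
move=> /le_trans; apply.
rewrite mulrDl -[leLHS]addr0 lerD//; last first.
  by rewrite mulr_ge0 ?addr_ge0 ?sqr_ge0// mulr_ge0.
rewrite [3 * _]mulrC -mulrA ler_wpM2l//.
set x := fnorm _; set y := fnorm _.
have h1 := sqr_ge0 (x - y); have h2 := sqr_ge0 (x - e); have h3 := sqr_ge0 (y - e).
nra.
Qed.

Section sample_error_mean.
Context {R : realType} (d N : nat).
Context {disp : measure_display} {Omega : measurableType disp} (P : probability Omega R).
Variable X : 'I_N.+1 -> Omega -> 'cV[R]_d.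
Variables (m : 'cV[R]_d) (s : 'M[R]_d) (M : R).
Hypothesis lX : forall i, law P (X i) (gauss m s).
Hypothesis indX : forall i k, i != k -> forall A B, measurable A -> measurable B ->
  (P (X i @^-1` A `&` X k @^-1` B) = gauss m s A * gauss m s B)%E.

(** [Z] collects the squared norm [A] of the error on the mean with weight 5
    (once for itself, four times for the rank-one term of [scov_centered]) and
    the square of the averaged part of the error on the covariance, with
    weight 4; see [capped_sqr_le]. *)
Lemma sample_error_mean (N0 : (0 < N)%N) (ps : psdmx s) (sM : fnorm s <= M) :
  exists Z : Omega -> R, [/\ intble P Z,
    mean P Z <= (5 * (@fnorm R d d 1%:M * M * mean_fsq d) +
      16 * (@fnorm R d d 1%:M * M * mean_fsq_outer d *
        (@fnorm R d d 1%:M * M)) + 8 * M ^+ 2) / N%:R &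
    forall w, fsq (m - smean (fun i => X i w)) +
      capped_sqr (fnorm (s - scov (fun i => X i w))) <= Z w].
Proof.
set n1 := @fnorm R d d 1%:M.
have n10 : 0 <= n1 by exact: fnorm_ge0.
have M0 : 0 <= M by rewrite (le_trans (fnorm_ge0 s)).
have aM : fsq (sqrtmx s) <= n1 * M.
  by rewrite (le_trans (fsq_sqrtmx ps))// ler_wpM2l.
have a0 := fsq_ge0 (sqrtmx s).
have K10 : 0 <= @mean_fsq R d by apply: mean_ge0 => v; exact: fsq_ge0.
have K20 : 0 <= @mean_fsq_outer R d by apply: mean_ge0 => v; exact: fsq_ge0.
have [I1 E1] := mean_fsq_sum lX indX (gauss_centered m s).
have [I2 E2] := mean_fsq_sum lX indX (gauss_outer_centered m ps).
move: I1 E1 I2 E2.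
set f1 := fun t => fsq _; set f2 := fun t => fsq _ => I1 E1 I2 E2.
have Np : 0 < N%:R :> R by rewrite ltr0n.
have Nn : N%:R != 0 :> R by rewrite gt_eqF.
have N1 : 1 <= N%:R :> R by rewrite ler1n.
have S0 : 0 < N.+1%:R :> R by rewrite ltr0n.
pose c1 := 5 / N.+1%:R ^+ 2 : R. pose c2 := 8 / N%:R ^+ 2 : R.
exists (fun w => c1 * f1 w + (c2 * f2 w + c2 * fsq s)).
have Ic := intbleD (intbleZ c2 I2) (intble_cst P (c2 * fsq s)).
split.
- by apply: intbleD => //; exact: intbleZ.
- rewrite meanD//; last exact: intbleZ.
  rewrite meanZ// meanD; [|exact: intbleZ|exact: intble_cst].
  rewrite meanZ// mean_cst.
  have ss : fsq s <= M ^+ 2 by rewrite -sqr_fnorm ler_pXn2r ?nnegrE.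
  set K1 := mean_fsq d in K10 E1 *; set K2 := mean_fsq_outer d in K20 E2 *.
  set a := fsq (sqrtmx s) in aM a0 E1 E2; set L := n1 * M in aM *.
  have L0 : 0 <= L by exact: le_trans aM.
  have SN : N%:R <= N.+1%:R :> R by rewrite ler_nat.
  have S2N : N.+1%:R <= 2 * N%:R :> R.
    by rewrite -natrM ler_nat mul2n -addnn -addn1 leq_add2l.
  have b1 : c1 * mean P f1 <= 5 * (L * K1) / N%:R.
    apply: (@le_trans _ _ (c1 * (N.+1%:R * (a * K1)))).
      by rewrite ler_wpM2l// /c1 divr_ge0// sqr_ge0.
    have -> : c1 * (N.+1%:R * (a * K1)) = 5 * (a * K1) / N.+1%:R.
      by rewrite /c1; field; rewrite gt_eqF.
    apply: ler_pM.
    - by rewrite mulr_ge0// mulr_ge0.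
    - by rewrite invr_ge0 ltW.
    - by rewrite ler_wpM2l// ler_wpM2r.
    - by rewrite lef_pV2 ?posrE.
  have b2 : c2 * mean P f2 <= 16 * (L * K2 * L) / N%:R.
    apply: (@le_trans _ _ (c2 * (2 * N%:R * (L * K2 * L)))).
      rewrite ler_wpM2l//; first by rewrite /c2 divr_ge0// sqr_ge0.
      apply: (le_trans E2); apply: ler_pM => //; first by rewrite !mulr_ge0.
      by apply: ler_pM => //; [rewrite mulr_ge0|rewrite ler_wpM2r].
    by rewrite /c2 le_eqVlt; apply/orP; left; apply/eqP; field.
  have b3 : c2 * fsq s <= 8 * M ^+ 2 / N%:R.
    have -> : 8 * M ^+ 2 / N%:R = 8 / N%:R * M ^+ 2 by ring.
    apply: ler_pM => //; first by rewrite /c2 divr_ge0// sqr_ge0.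
    rewrite /c2 ler_pM2l// lef_pV2 ?posrE ?exprn_gt0//.
    by rewrite expr2 ler_peMl// ltW.
  by rewrite mulrDl mulrDl -addrA lerD// lerD.
- move=> w; set x := fun i => X i w.
  set u := smean x - m.
  have Sn : N.+1%:R != 0 :> R by rewrite gt_eqF.
  have uE : fsq u = f1 w / N.+1%:R ^+ 2.
    by rewrite /u smean_centered fsqZ exprVn mulrC.
  set T := N%:R^-1 *: (\sum_i ((x i - m) *m (x i - m)^T - s) + s).
  have TE : fsq T <= 2 * (f2 w + fsq s) / N%:R ^+ 2.
    rewrite /T fsqZ exprVn mulrC ler_wpM2r ?invr_ge0 ?sqr_ge0//.
    exact: fsqD_le.
  have u0 := fsq_ge0 u.
  have EE : fnorm ((N.+1%:R / N%:R) *: (u *m u^T)) <= 2 * fsq u.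
    have SN0 : 0 <= N.+1%:R / N%:R :> R by rewrite divr_ge0 ?ltW.
    rewrite fnormZ ger0_norm//; apply: ler_pM => //.
      by rewrite ler_pdivrMr// -natrM ler_nat mul2n -addnn -addn1 leq_add2l.
    by rewrite (le_trans (fnormM _ _))// fnormT -expr2 sqr_fnorm.
  have scE : fnorm (s - scov x) <= fnorm T + 2 * fsq u.
    rewrite fnormB (scov_centered x m s N0) -/u -/T (le_trans (fnormD _ _))//.
    rewrite fnormN lerD2l.
    exact: EE.
  have := capped_sqr_le (fnorm_ge0 (s - scov x)) (fnorm_ge0 T)
    (mulr_ge0 (ler0n _ 2) u0) scE.
  rewrite sqr_fnorm => cE.
  have -> : fsq (m - smean x) = fsq u by rewrite -fsqN opprB.
  have -> : c1 * f1 w + (c2 * f2 w + c2 * fsq s) =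
    5 * (f1 w / N.+1%:R ^+ 2) + 4 * (2 * (f2 w + fsq s) / N%:R ^+ 2).
    by rewrite /c1 /c2; ring.
  rewrite -uE; lra.
Qed.

End sample_error_mean.

(** * The convergence rate *)

(** Each column of [A] is the image of a unit vector. *)
Lemma fnorm_specnorm (R : realType) d (A : 'M[R]_d) up : specnorm A <= up ->
  fnorm A <= Num.sqrt (d%:R * up ^+ 2).
Proof.
move=> Aup.
have colA j : fnorm (col j A) <= up.
  apply: le_trans Aup; apply: sup_ubound.
    exists (fnorm A) => _ [x /= x1 <-].
    rewrite enormE (le_trans (fnormM _ _))// -[leRHS]mulr1 ler_wpM2l//.
    by rewrite -enormE.
  exists (delta_mx j 0); last by rewrite enormE -colE.
  rewrite /= enormE -(@ler_pXn2r _ 2) ?nnegrE// sqr_fnorm expr1n.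
  rewrite fsqE big_ord_recl big_ord0 addr0 (bigD1 j)//= mxE !eqxx expr1n.
  by rewrite big1 ?addr0// => i ij; rewrite mxE (negbTE ij) expr0n.
rewrite /fnorm ler_wsqrtr// fsq_col -[d in d%:R]card_ord mulr_natl -sumr_const.
apply: ler_sum => j _; rewrite -sqr_fnorm ler_pXn2r ?nnegrE//.
exact: le_trans (colA j).
Qed.

Lemma qform_lambda_min (R : realType) d (A : 'M[R]_d) lo : psdmx A ->
  lo <= lambda_min A -> forall x, lo * fsq x <= qform A x.
Proof.
move=> pA loA; apply: qform_ge_eigen; first exact: psdmx_sym.
move=> l eigl; apply: (le_trans loA); apply: ge_inf => //.
by exists 0 => k; exact: eigenvalue_psd_ge0.
Qed.

Section iid.
Context {R : realType} {d N : nat} {disp : measure_display}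
  {Omega : measurableType disp} {P : probability Omega R}.
Variables (X Y : 'I_N -> {RV P >-> 'cV[R]_d}) (mu nu : probability 'cV[R]_d R).
Hypothesis XY : iid_samples X Y mu nu.

Lemma iid_law : (forall i, law P (X i) mu) /\ (forall i, law P (Y i) nu).
Proof.
case: XY => lX lY _; split=> i; split; try exact: measurable_funP.
  by move=> A mA; exact: lX.
by move=> A mA; exact: lY.
Qed.

Lemma mutually_independent_pair (I : finType) (Z : I -> {RV P >-> 'cV[R]_d}) i k :
  mutually_independent Z -> i != k ->
  forall A B, measurable A -> measurable B ->
  (P (Z i @^-1` A `&` Z k @^-1` B) = P (Z i @^-1` A) * P (Z k @^-1` B))%E.
Proof.
move=> iZ ik A B mA mB; pose C j := if j == i then A else B.
have := iZ [set i; k]%SET C.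
rewrite big_setU1 ?inE//= big_set1 /C eqxx eq_sym (negbTE ik).
move=> <-; last by move=> j; case: ifP.
congr (P _); apply/seteqP; split => w /=.
  move=> [hi hk] j /=; rewrite !inE => /orP[] /eqP ->; rewrite ?eqxx//.
  by rewrite eq_sym (negbTE ik).
move=> h; split.
  by have := h i; rewrite /= !inE eqxx; apply.
by have := h k; rewrite /= !inE eqxx orbT eq_sym (negbTE ik); apply.
Qed.

Lemma iid_indep :
  (forall i k, i != k -> forall A B, measurable A -> measurable B ->
    (P (X i @^-1` A `&` X k @^-1` B) = mu A * mu B)%E) /\
  (forall i k, i != k -> forall A B, measurable A -> measurable B ->
    (P (Y i @^-1` A `&` Y k @^-1` B) = nu A * nu B)%E).
Proof.
have [lX lY] := iid_law; case: XY => _ _ iXY; split=> i k ik A B mA mB.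
  have := @mutually_independent_pair _ _ (inl i) (inl k) iXY ik A B mA mB.
  by rewrite (lX i).2// (lX k).2.
have := @mutually_independent_pair _ _ (inr i) (inr k) iXY ik A B mA mB.
by rewrite (lY i).2// (lY k).2.
Qed.

End iid.

(** The constant precedes the samples and the probability space, so that it can
    be chosen as a function of [chi], [lo] and [up] alone. *)
Lemma bridge_error_bound (R : realType) d (chi : 'M[R]_d) (lo up : R) :
  exists2 C, 0 <= C & forall (eps : R) (N : nat) (m n : 'cV[R]_d) (s v : 'M[R]_d)
    (disp : measure_display) (Omega : measurableType disp)
    (P : probability Omega R) (X Y : 'I_N.+1 -> {RV P >-> 'cV[R]_d}),
  0 < eps -> (0 < N)%N -> chi \in unitmx -> 0 < lo -> psdmx s -> psdmx v ->
  (forall x, lo * fsq x <= qform s x) -> (forall x, lo * fsq x <= qform v x) ->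
  fnorm s <= up -> fnorm v <= up ->
  iid_samples X Y (gauss m s) (gauss n v) ->
  (\int[P]_w
     (wasserstein2 sqdist_pair (bridge chi m s n v)
        (bridge_eps chi eps (smean (fun i => X i w)) (scov (fun i => X i w))
          (smean (fun i => Y i w)) (scov (fun i => Y i w))) ^+ 2)
   <= (C * (N%:R^-1 + eps ^+ 2))%:E)%E.
Proof.
have [uc|uc] := boolP (chi \in unitmx); last first.
  by exists 0 => // eps N m n s v disp Omega P X Y _ _; rewrite (negbTE uc).
have [lo0|lo0] := boolP (0 < lo); last first.
  by exists 0 => // eps N m n s v disp Omega P X Y _ _ _; rewrite (negbTE lo0).
have [up0|up0] := boolP (0 <= up); last first.
  exists 0 => // eps N m n s v disp Omega P X Y _ _ _ _ _ _ _ _ sup.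
  by rewrite (le_trans _ sup) in up0.
have [C0 C00 HC] := gap_capped uc lo0 up0.
pose L := @fnorm R d d 1%:M * up.
pose K := 5 * (L * mean_fsq d) + 16 * (L * mean_fsq_outer d * L) + 8 * up ^+ 2.
have L0 : 0 <= L by rewrite mulr_ge0.
have M10 : 0 <= @mean_fsq R d by apply: mean_ge0 => z; exact: fsq_ge0.
have M20 : 0 <= @mean_fsq_outer R d by apply: mean_ge0 => z; exact: fsq_ge0.
have K0 : 0 <= K by rewrite /K !addr_ge0// ?mulr_ge0// ?sqr_ge0.
pose C1 := 3 * (1 + mean_fsq d) * (1 + C0).
have C10 : 0 <= C1 by rewrite /C1 !mulr_ge0// addr_ge0.
exists (C1 * (2 * K + 1)); first by rewrite mulr_ge0// addr_ge0// mulr_ge0.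
move=> eps N m n s v disp Omega P X Y eps0 N0 _ _ ps pv slo vlo sup vup XY.
have [lX lY] := iid_law XY. have [iX iY] := iid_indep XY.
have [ZX [IX EX HX]] := sample_error_mean lX iX N0 ps sup.
have [ZY [IY EY HY]] := sample_error_mean lY iY N0 pv vup.
have IZ : intble P (fun w => ZX w + (ZY w + eps ^+ 2)).
  by apply: intbleD => //; apply: intbleD => //; exact: intble_cst.
apply: (@le_trans _ _ (\int[P]_w (C1 * (ZX w + (ZY w + eps ^+ 2)))%:E)%E).
  apply: le_integral_nonmeasurable => w; first by rewrite sqre_ge0.
  apply: (le_trans (wasserstein_bridge_le _ _ _ _ _ _ _ _ _)); rewrite lee_fin.
  rewrite /C1 -[leRHS]mulrA ler_wpM2l ?mulr_ge0 ?addr_ge0//.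
  set x := fun i => X i w; set y := fun i => Y i w.
  have arith (f g G a b e zx zy : R) : 0 <= f -> 0 <= g -> 0 <= e -> 0 <= a -> 0 <= b ->
      G <= C0 * (a + b + e) -> f + a <= zx -> g + b <= zy ->
      f + g + G <= (1 + C0) * (zx + (zy + e)).
    move=> f0 g0 e0 a0 b0 hG hX hY.
    have q1 := mulr_ge0 C00 f0; have q2 := mulr_ge0 C00 g0.
    have q3 := ler_wpM2l C00 hX; have q4 := ler_wpM2l C00 hY.
    lra.
  apply: (arith _ _ _ _ _ _ _ _ (fsq_ge0 _) (fsq_ge0 _) (sqr_ge0 eps)
    (capped_sqr_ge0 (fnorm_ge0 _)) (capped_sqr_ge0 (fnorm_ge0 _)) _ (HX w) (HY w)).
  exact: HC (psd_scov x) (psd_scov y) slo vlo sup vup eps0.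
rewrite meanE; last exact: intbleZ.
rewrite meanZ// lee_fin -[leRHS]mulrA ler_wpM2l//.
rewrite meanD//; last by apply: intbleD => //; exact: intble_cst.
rewrite meanD//; last exact: intble_cst.
rewrite mean_cst.
have Ni : 0 <= N%:R^-1 :> R by rewrite invr_ge0.
have e0 := sqr_ge0 eps.
have := mulr_ge0 K0 e0.
have {}EX : mean P ZX <= K * N%:R^-1 by exact: EX.
have {}EY : mean P ZY <= K * N%:R^-1 by exact: EY.
lra.
Qed.

Theorem corollary6p3 (R : realType) :
  exists C : R -> R -> R -> R -> (forall d : nat, 'M[R]_d -> R),
  forall (eps : R) (d N : nat) (a b Clow Cup : R)
    (m n : 'cV[R]_d) (sigma varsigma beta tau : 'M[R]_d)
    (disp : measure_display) (Omega : measurableType disp)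
    (P : probability Omega R) (X Y : 'I_N.+1 -> {RV P >-> 'cV[R]_d}),
  let chi := invmx tau *m beta in
  let hat_m w := smean (fun i => X i w) in
  let hat_sigma w := scov (fun i => X i w) in
  let hat_n w := smean (fun i => Y i w) in
  let hat_varsigma w := scov (fun i => Y i w) in
  let B := bridge_law chi m n (kappa chi sigma varsigma) in
  0 < eps -> (0 < d)%N -> (0 < N)%N ->
  pdmx sigma -> pdmx varsigma -> pdmx tau ->
  iid_samples X Y (gauss m sigma) (gauss n varsigma) ->
  0 <= a ->
  (forall x x' : 'cV[R]_d,
    (wasserstein2 sqdist (B x) (B x') <= (a * enorm (x - x'))%:E)%E) ->
  0 < Clow <= Cup ->
  Clow <= Num.min (lambda_min sigma) (lambda_min varsigma) ->
  Num.max (specnorm sigma) (specnorm varsigma) <= Cup ->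
  pdmx (chi *m chi^T) ->
  ('E_P[fun w => (moment_max (hat_sigma w) (hat_varsigma w) ^+ 2)%R] <= b%:E)%E ->
  (\int[P]_w
     (wasserstein2 sqdist_pair
        (bridge chi m sigma n varsigma)
        (bridge_eps chi eps (hat_m w) (hat_sigma w) (hat_n w) (hat_varsigma w))
      ^+ 2)
   <= (C a b Clow Cup d chi * d%:R * ((1 + eps ^- 2) / N%:R + eps ^+ 2))%:E)%E.
Proof.
pose K d (chi : 'M[R]_d) lo up :=
  s2val (cid2 (bridge_error_bound chi lo (Num.sqrt (d%:R * up ^+ 2)))).
exists (fun _ _ lo up d chi => K d chi lo up).
move=> eps d N a b lo up m n s v beta tau disp Omega P X Y /=.
move=> eps0 d0 N0 pds pdv _ XY _ _ /andP[lo0 _]; rewrite le_min ge_max.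
move=> /andP[los lov] /andP[sup vup] pchi _.
set chi := invmx tau *m beta in pchi *.
rewrite /K; case: cid2 => C C0 /= HC.
have uc : chi \in unitmx by have := pdmx_unit pchi; rewrite unitmx_mul => /andP[].
have ps := pdmx_psd pds. have pv := pdmx_psd pdv.
apply: (le_trans (HC eps N m n s v disp Omega P X Y eps0 N0 uc lo0 ps pv
  (qform_lambda_min ps los) (qform_lambda_min pv lov)
  (fnorm_specnorm sup) (fnorm_specnorm vup) XY)).
rewrite lee_fin -mulrA ler_wpM2l//.
have d1 : 1 <= d%:R :> R by rewrite ler1n.
have Ni : 0 <= N%:R^-1 :> R by rewrite invr_ge0.
have ei : 0 <= eps ^- 2 by rewrite invr_ge0 sqr_ge0.
have e0 := sqr_ge0 eps.
have h : N%:R^-1 + eps ^+ 2 <= (1 + eps ^- 2) / N%:R + eps ^+ 2.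
  by rewrite lerD2r mulrDl mul1r lerDl mulr_ge0.
rewrite (le_trans h)// ler_peMl//.
by rewrite addr_ge0// mulr_ge0// addr_ge0.
Qed.
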